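(* The problem Mersenne-Number-SAT is $\mathbf{MNS}$-complete: it belongs to $\mathbf{MNS}$, and every language in $\mathbf{MNS}$ is polynomial-time many-one reducible to it.
   Context: A Mersenne number is an integer of the form $2^t-1$ with $t\in\{1,2,3,\dots\}$. A language $L$ is in the complexity class $\mathbf{MNS}$ if there exist a polynomial $p$ and a polynomial-time computable predicate $R$ such that for every $x$: $x\in L \iff |\{y : |y|=p(|x|) \wedge R(x,y)\}| = 2^t-1$ for some $t\in\{1,2,3,\dots\}$. Mersenne-Number-SAT is the problem: given a Boolean formula in conjunctive normal form, decide whether its number of satisfying truth assignments is a Mersenne number. *)

(* Defs.v *)
From HB Require Import structures.
From mathcomp Require Import all_boot all_order all_algebra.

Set Implicit Arguments.
Unset Strict Implicit.
Unset Printing Implicit Defensive.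

Definition word := seq bool.
Definition language := word -> Prop.

Inductive move := MoveL | MoveS | MoveR.

(* A tape is infinite in both directions.  [(l, r)] stands for the contents
   ... l1 l0 [r0] r1 r2 ... with the head on [r0]; all the cells beyond the ends
   of the two lists are blank. *)
Definition tape (S : Type) := (seq (option S) * seq (option S))%type.

Section Tape.
Variable S : Type.

Definition tape_read (t : tape S) : option S := head None t.2.

Definition tape_update (t : tape S) (am : option S * move) : tape S :=
  let: (l, r) := t in
  let: (a, m) := am in
  match m with
  | MoveL => (behead l, head None l :: a :: behead r)
  | MoveS => (l, a :: behead r)
  | MoveR => (a :: l, behead r)
  end.

End Tape.

(* A machine with [r] input tapes, one per argument, each holding a binary
   word. The tape [None] is the output tape, [Some (inl i)] is the [i]-th input
   tape, [Some (inr j)] is the [j]-th work tape.  All tapes are read-write.  The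
   tape alphabet consists of the blank [None], the bits [Some (inl b)], and
   finitely many further symbols [Some (inr s)]. *)
Record machine (r : nat) := Machine {
  state : finType;
  extra_symbol : finType;
  work_tapes : nat;
  start : state;
  halting : pred state;
  transition :
    state ->
    {ffun option ('I_r + 'I_work_tapes) -> option (bool + extra_symbol)} ->
    state *
    {ffun option ('I_r + 'I_work_tapes) -> option (bool + extra_symbol) * move}
}.

Section Run.
Variables (r : nat) (M : machine r).

Definition tape_id : finType := option ('I_r + 'I_(work_tapes M)).
Definition symbol : finType := (bool + extra_symbol M)%type.
Definition config := (state M * {ffun tape_id -> tape symbol})%type.

Definition bits_tape (w : word) : tape symbol :=
  ([::], [seq Some (inl b) | b <- w]).

Definition init_config (args : r.-tuple word) : config :=
  (start M,
   [ffun i : tape_id =>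
      if i is Some (inl k) then bits_tape (tnth args k) else bits_tape [::]]).

Definition step (c : config) : config :=
  if halting c.1 then c else
  let: (q, act) := transition c.1 [ffun i => tape_read (c.2 i)] in
  (q, [ffun i => tape_update (c.2 i) (act i)]).

Fixpoint leading_bits (s : seq (option symbol)) : word :=
  if s is Some (inl b) :: s' then b :: leading_bits s' else [::].

(* The output is the maximal block of bits on the output tape that starts under
   the head and extends to the right. *)
Definition output (c : config) : word := leading_bits (c.2 None).2.

(* Halting configurations are fixed points of [step], hence this says that the
   machine halts within [n] steps with output [w]. *)
Definition outputs_within (n : nat) (args : r.-tuple word) (w : word) : Prop :=
  let c := iter n step (init_config args) in halting c.1 /\ output c = w.

End Run.

Definition poly_time (r : nat) (f : r.-tuple word -> word) : Prop :=
  exists (M : machine r) (q : {poly nat}),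
  forall args : r.-tuple word,
    outputs_within M q.[(\sum_(i < r) size (tnth args i))%N]%R args (f args).

Definition poly_time_fun (f : word -> word) : Prop :=
  poly_time (fun args : 1.-tuple word => f (tnth args ord0)).

Definition poly_time_pred2 (R : word -> word -> bool) : Prop :=
  poly_time (fun args : 2.-tuple word =>
               [:: R (tnth args ord0) (tnth args ord_max)]).

Definition many_one_reducible (L L' : language) : Prop :=
  exists2 f : word -> word, poly_time_fun f & forall x, L x <-> L' (f x).

Definition mersenne (n : nat) : Prop := exists2 t : nat, 1 <= t & n = 2 ^ t - 1.

Definition MNS (L : language) : Prop :=
  exists (p : {poly nat}) (R : word -> word -> bool),
    poly_time_pred2 R /\
    forall x, L x <-> mersenne #|[set y : (p.[size x]%R).-tuple bool | R x y]|.

(* Variables are named by binary words; the literal [(true, v)] is [v] and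
   [(false, v)] is its negation. *)
Definition variable := word.
Definition literal := (bool * variable)%type.
Definition clause := seq literal.
Definition cnf := seq clause.

Definition vars (phi : cnf) : seq variable := undup [seq l.2 | l <- flatten phi].

(* Truth assignments are defined on exactly the variables that occur. *)
Definition assignment (phi : cnf) := {ffun seq_sub (vars phi) -> bool}.

(* The default value [false] is never used for a variable of [phi]. *)
Definition value (phi : cnf) (a : assignment phi) (v : variable) : bool :=
  oapp a false (insub v).

Definition satisfies (phi : cnf) (a : assignment phi) : bool :=
  all (fun c : clause => has (fun l : literal => value a l.2 == l.1) c) phi.

Definition num_sat (phi : cnf) : nat :=
  #|[set a : assignment phi | satisfies a]|.

(* Formulas are first written over four tokens, each coded by two bits: the bits
   0 (00) and 1 (01), the start of a literal (10), the start of a clause (11).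
   A literal is its mark, its sign, and the name of its variable. *)
Definition encode_bits (w : word) : word := flatten [seq [:: false; b] | b <- w].

Definition encode_literal (l : literal) : word :=
  [:: true; false] ++ encode_bits (l.1 :: l.2).

Definition encode_clause (c : clause) : word :=
  [:: true; true] ++ flatten (map encode_literal c).

Definition encode (phi : cnf) : word := flatten (map encode_clause phi).

Definition MersenneNumberSAT : language :=
  fun x => exists2 phi : cnf, x = encode phi & mersenne (num_sat phi).

(* Main.v *)
From Stdlib Require Import FunctionalExtensionality.
From mathcomp Require Import all_boot all_order all_algebra.
From mathcomp Require Import zify.
Require Import Defs.

(* Hardness is the Cook-Levin construction, arranged to be parsimonious. Measure
   positions on every tape from its head, and let column [j] of a configuration
   consist of the state and of the cells at distance [j] from the heads. Column
   [j] at time [t + 1] is then a fixed function of the columns [0], [j - 1], [j]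
   and [j + 1] at time [t]. With one Boolean variable for each time, position and
   column value, the clauses determine row [t + 1] from row [t], and row 0 from
   the witness bits, so that the satisfying assignments correspond to the
   accepted witnesses. Only the cells with [t + j < B] are described: they suffice
   for column 0 at time [B - 1] and make any clause about a right border
   superfluous.

   For membership the witness lists the values of the variables in the order of
   their first occurrence from the right, padded with zeros.

   Polynomial-time machines come from a small language of programs on stacks of
   bits, each stack being kept on one tape, to the right of its head. *)

Set Implicit Arguments.
Unset Strict Implicit.
Unset Printing Implicit Defensive.

(** * Stack programs *)

(** Membership in the target language depends on the exact number of models, so the reduction must
    preserve it: no auxiliary variable may stay free, and each column variable is fixed whether it
    is true or false. Conversely, a witness bit that the machine never reads must still occur in the
    formula, since both its values are counted; this is why [B] is made at least the witness length.
    Measuring from the heads replaces markers for head positions by one rule for all columns. The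
    price is that column 0, which alone shows the scanned symbols, enters every rule. For
    membership, witnesses have a fixed length and must be in bijection with assignments, so surplus
    bits get a prescribed value. Scanning from the right suits [vars], because [undup] keeps last
    occurrences: the table of names met so far is then [undup] of the names read. A formula has at
    most as many variables as its code has bits, so the input length serves as witness length. Words
    that encode no formula get no witness, and 0 is not a Mersenne number because [1 <= t]. *)

Definition store := nat -> word.

Definition upd (s : store) (i : nat) (w : word) : store :=
  fun k => if k == i then w else s k.

Inductive cmd :=
  | Skip
  | Push of nat & bool
  | Pop of nat
  | Seq of cmd & cmd
  | Case of nat & cmd & cmd & cmd
  | While of nat & cmd & cmd.

(* [Case i P Q R] branches on the top of stack [i] (empty, true, false) without
   popping it; [While i P Q] pops the top of stack [i] until the stack is empty
   and runs [P] or [Q] according to the bit popped. *)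
Inductive exec : cmd -> store -> store -> nat -> Prop :=
  | ExecSkip s : exec Skip s s 0
  | ExecPush i b s : exec (Push i b) s (upd s i (b :: s i)) 2
  | ExecPop i s : exec (Pop i) s (upd s i (behead (s i))) 1
  | ExecSeq P Q s1 s2 s3 t1 t2 :
      exec P s1 s2 t1 -> exec Q s2 s3 t2 -> exec (Seq P Q) s1 s3 (t1 + t2)
  | ExecCase i P Q R s s' t :
      exec (if s i is b :: _ then if b then Q else R else P) s s' t ->
      exec (Case i P Q R) s s' (t + 2)
  | ExecWhileNil i P Q s : s i = [::] -> exec (While i P Q) s s 1
  | ExecWhileCons i P Q s s' s'' b w t t' :
      s i = b :: w ->
      exec (if b then P else Q) (upd s i w) s' t ->
      exec (While i P Q) s' s'' t' ->
      exec (While i P Q) s s'' (t + 2 + t')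
  | ExecWeaken P s s' t t' : exec P s s' t -> t <= t' -> exec P s s' t'.

(** * Compilation of stack programs to multi-tape machines *)

Section Compile.

(* The register acted upon, and, as a function of the symbol read there, the
   symbol written, the move and the next address. *)
Definition instr := (nat * (option bool -> option bool * move * nat))%type.

Fixpoint clen (P : cmd) : nat :=
  match P with
  | Skip => 0
  | Push _ _ => 2
  | Pop _ => 1
  | Seq P Q => clen P + clen Q
  | Case _ P Q R => clen P + clen Q + clen R + 3
  | While _ P Q => clen P + clen Q + 3
  end.

(** Every instruction acts on some register; register 0 has a tape in every machine, and the symbol
    read there is written back. *)
Definition jump (pc : nat) : instr := (0, fun o => (o, MoveS, pc)).

Fixpoint compile (P : cmd) (pc : nat) : seq instr :=
  match P with
  | Skip => [::]
  | Push i b => [:: (i, fun o => (o, MoveL, pc.+1));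
                    (i, fun _ => (Some b, MoveS, pc.+2))]
  | Pop i => [:: (i, fun _ => (None, MoveR, pc.+1))]
  | Seq P Q => compile P pc ++ compile Q (pc + clen P)
  | Case i P Q R =>
      (i, fun o => (o, MoveS,
             match o with
             | None => pc.+1
             | Some true => pc.+2 + clen P
             | Some false => pc.+3 + clen P + clen Q
             end)) ::
      compile P pc.+1 ++ jump (pc + clen (Case i P Q R)) ::
      compile Q (pc.+2 + clen P) ++ jump (pc + clen (Case i P Q R)) ::
      compile R (pc.+3 + clen P + clen Q)
  | While i P Q =>
      (i, fun o =>
             match o with
             | None => (None, MoveS, pc + clen (While i P Q))
             | Some true => (None, MoveR, pc.+1)
             | Some false => (None, MoveR, pc.+2 + clen P)
             end) ::
      compile P pc.+1 ++ jump pc :: compile Q (pc.+2 + clen P) ++ [:: jump pc]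
  end.

Lemma size_compile P pc : size (compile P pc) = clen P.
Proof.
elim: P pc => //= [P IHP Q IHQ|i P IHP Q IHQ R IHR|i P IHP Q IHQ] pc;
  rewrite ?size_cat /= ?size_cat /= ?IHP ?IHQ ?IHR /=; lia.
Qed.

Fixpoint maxreg (P : cmd) : nat :=
  match P with
  | Skip => 0
  | Push i _ | Pop i => i
  | Seq P Q => maxn (maxreg P) (maxreg Q)
  | Case i P Q R => maxn i (maxn (maxreg P) (maxn (maxreg Q) (maxreg R)))
  | While i P Q => maxn i (maxn (maxreg P) (maxreg Q))
  end.

Variables (r : nat) (prog : cmd).
Let code := compile prog 0.
Let W := maxreg prog.
Let tid : finType := option ('I_r + 'I_W).

(** The arguments start out in registers 1 to [r]. With [W] work tapes every register of the program
    has a tape, whatever [r] is. *)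
Definition register (x : tid) : nat :=
  match x with
  | None => 0
  | Some (inl i) => i.+1
  | Some (inr j) => r + j.+1
  end.

Lemma register_inj : injective register.
Proof.
case=> [[i|i]|] [[j|j]|] //=; try (have := ltn_ord i); try (have := ltn_ord j);
  try lia.
- by move=> _ _ [/val_inj ->].
- by move=> _ _ E; congr (Some (inr _)); apply: val_inj => /=; lia.
Qed.

Lemma register_onto i : i <= W -> exists x, register x = i.
Proof.
case: i => [|i] iW; first by exists None.
case: (ltnP i r) => ir; first by exists (Some (inl (Ordinal ir))).
have jW : i - r < W by lia.
by exists (Some (inr (Ordinal jW))) => /=; lia.
Qed.

Definition sym_bit (o : option (bool + void)) : option bool :=
  if o is Some (inl b) then Some b else None.

Definition bit_sym (o : option bool) : option (bool + void) := omap inl o.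

Lemma bit_symK : cancel bit_sym sym_bit. Proof. by case. Qed.

Definition prog_trans (pc : 'I_(size code).+1)
    (rd : {ffun tid -> option (bool + void)}) :
    'I_(size code).+1 * {ffun tid -> option (bool + void) * move} :=
  let: (i, g) := nth (jump 0) code pc in
  let o := if [pick x | register x == i] is Some x then sym_bit (rd x) else None in
  let: (o', m, pc') := g o in
  (inord pc',
   [ffun x => if register x == i then (bit_sym o', m) else (rd x, MoveS)]).

Definition prog_machine : machine r :=
  @Machine r 'I_(size code).+1 void W ord0
    (fun pc : 'I__ => pc == size code :> nat) prog_trans.

(** Tape lists are not normalised: a pop leaves a blank on the left, and writing a blank back
    lengthens an empty list. So any number of blanks is allowed on both sides. *)
Definition stack_tape (t : tape (bool + void)) (w : word) :=
  (exists k, t.1 = nseq k None) /\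
  (exists k, t.2 = [seq Some (inl b) | b <- w] ++ nseq k None).

Definition represents (c : config prog_machine) (pc : nat) (s : store) :=
  c.1 = pc :> nat /\ forall x : tid, stack_tape (c.2 x) (s (register x)).

Lemma stack_tape_read t w : stack_tape t w -> tape_read t = bit_sym (ohead w).
Proof. by case: t => l rt [_ [k /= ->]]; case: w => //; case: k. Qed.

Lemma stack_tape_stay t w :
  stack_tape t w -> stack_tape (tape_update t (tape_read t, MoveS)) w.
Proof.
case: t => l rt [[k' /= ->] [k /= ->]]; split => /=; first by exists k'.
by case: w => [|b w] /=; [exists (k.-1.+1); case: k | exists k].
Qed.

Lemma stack_tape_pop t w :
  stack_tape t w -> stack_tape (tape_update t (None, MoveR)) (behead w).
Proof.
case: t => l rt [[k' /= ->] [k /= ->]]; split => /=; first by exists k'.+1.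
by case: w => [|b w] /=; [exists k.-1; case: k | exists k].
Qed.

Lemma stack_tape_push t w b :
  stack_tape t w ->
  stack_tape (tape_update (tape_update t (tape_read t, MoveL)) (Some (inl b), MoveS))
    (b :: w).
Proof.
case: t => l rt [[k' /= ->] [k /= ->]]; split => /=.
  by exists k'.-1; case: k'.
by case: w => [|a w] /=; [exists (k.-1.+1); case: k | exists k].
Qed.

Lemma step_instr (c : config prog_machine) i g a m pc' (x0 : tid) :
  c.1 < size code -> nth (jump 0) code c.1 = (i, g) ->
  register x0 = i -> g (sym_bit (tape_read (c.2 x0))) = (a, m, pc') ->
  pc' <= size code ->
  (step c).1 = pc' :> nat /\
  forall x : tid, (step c).2 x =
    if register x == i then tape_update (c.2 x) (bit_sym a, m)
    else tape_update (c.2 x) (tape_read (c.2 x), MoveS).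
Proof.
move=> ltc Ec Ex0 Eg le'.
have nh : c.1 != size code :> nat by rewrite neq_ltn ltc.
rewrite /step /= (negPf nh) /prog_trans Ec.
have -> : [pick x | register x == i] = Some x0.
  case: pickP => [x /eqP Ex|/(_ x0)]; last by rewrite Ex0 eqxx.
  by congr Some; apply: register_inj; rewrite Ex.
rewrite ffunE Eg /= inordK //; split=> // x.
by rewrite !ffunE; case: ifP.
Qed.

Lemma step_stay c pc s i g o pc' :
  represents c pc s -> pc < size code -> nth (jump 0) code pc = (i, g) ->
  i <= W -> ohead (s i) = o -> g o = (o, MoveS, pc') -> pc' <= size code ->
  represents (step c) pc' s.
Proof.
move=> [E1 E2] ltc Ec /register_onto [x0 Ex0] Eo Eg le'.
have Er x : register x = i -> tape_read (c.2 x) = bit_sym o.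
  by move=> Ex; rewrite (stack_tape_read (E2 x)) Ex Eo.
have [|||H1 H2] := @step_instr c i g o MoveS pc' x0 _ _ Ex0 _ le';
  rewrite ?E1 ?Er ?bit_symK //; split=> // x; rewrite H2; case: eqP => Ex.
  by rewrite -(Er x Ex); apply: stack_tape_stay; apply: E2.
by apply: stack_tape_stay; apply: E2.
Qed.

Lemma step_pop c pc s i g pc' :
  represents c pc s -> pc < size code -> nth (jump 0) code pc = (i, g) ->
  i <= W -> g (ohead (s i)) = (None, MoveR, pc') -> pc' <= size code ->
  represents (step c) pc' (upd s i (behead (s i))).
Proof.
move=> [E1 E2] ltc Ec /register_onto [x0 Ex0] Eg le'.
have Er : tape_read (c.2 x0) = bit_sym (ohead (s i)).
  by rewrite (stack_tape_read (E2 x0)) Ex0.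
have [|||H1 H2] := @step_instr c i g None MoveR pc' x0 _ _ Ex0 _ le';
  rewrite ?E1 ?Er ?bit_symK //; split=> // x; rewrite H2 /upd; case: eqP => Ex.
  by rewrite -Ex; apply: stack_tape_pop; apply: E2.
by apply: stack_tape_stay; apply: E2.
Qed.

Lemma step_push c pc s i b :
  represents c pc s -> pc.+1 < size code ->
  nth (jump 0) code pc = (i, fun o => (o, MoveL, pc.+1)) ->
  nth (jump 0) code pc.+1 = (i, fun _ => (Some b, MoveS, pc.+2)) ->
  i <= W ->
  represents (step (step c)) pc.+2 (upd s i (b :: s i)).
Proof.
move=> [E1 E2] ltc Ec Ec' /register_onto [x0 Ex0].
have Er x : register x = i -> tape_read (c.2 x) = bit_sym (ohead (s i)).
  by move=> Ex; rewrite (stack_tape_read (E2 x)) Ex.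
have [|||H1 H2] := @step_instr c i (fun o => (o, MoveL, pc.+1)) (ohead (s i))
  MoveL pc.+1 x0 _ _ Ex0 _ (ltnW ltc); rewrite ?E1 ?Er ?bit_symK //; try exact: ltnW.
have [||H3 H4] := @step_instr (step c) i (fun _ => (Some b, MoveS, pc.+2)) (Some b)
  MoveS pc.+2 x0 _ _ Ex0 erefl ltc; rewrite ?H1 //; split=> // x.
rewrite H4 H2 /upd; case: eqP => Ex.
  by rewrite -(Er x Ex) -Ex; apply: stack_tape_push; apply: E2.
by do 2 apply: stack_tape_stay; apply: E2.
Qed.

Definition code_at (pc : nat) (cs : seq instr) :=
  exists pre post, size pre = pc /\ code = pre ++ cs ++ post.

Lemma code_at_cat pc cs cs' :
  code_at pc (cs ++ cs') -> code_at pc cs /\ code_at (pc + size cs) cs'.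
Proof.
move=> [pre [post [<- E]]]; split.
  by exists pre, (cs' ++ post); rewrite E !catA.
by exists (pre ++ cs), post; rewrite size_cat E !catA.
Qed.

Lemma code_at_cons pc i cs :
  code_at pc (i :: cs) ->
  [/\ pc < size code, nth (jump 0) code pc = i & code_at pc.+1 cs].
Proof.
move=> /(@code_at_cat _ [:: i]) [[pre [post [Es E]]] H]; split.
- by rewrite E !size_cat /=; lia.
- by rewrite E nth_cat -Es ltnn subnn.
- by rewrite -addn1.
Qed.

Lemma code_at_size pc P : code_at pc (compile P pc) -> pc + clen P <= size code.
Proof.
by move=> [pre [post [Es E]]]; rewrite E !size_cat size_compile; lia.
Qed.

(** Stated for code at any address, because subprograms sit inside [code], and because a [While]
    jumps back to its own start, where the hypothesis on the remaining rounds meets the same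
    code. *)
Lemma exec_represents P s s' t :
  exec P s s' t -> maxreg P <= W ->
  forall pc c, code_at pc (compile P pc) -> represents c pc s ->
  exists2 n, n <= t & represents (iter n (@step _ prog_machine) c) (pc + clen P) s'.
Proof.
elim=> {P s s' t} /=.
- by move=> s _ pc c _ Hc; exists 0; rewrite ?addn0.
- move=> i b s iW pc c /code_at_cons [lt0 E0 /code_at_cons [lt1 E1 _]] Hc.
  by exists 2 => //=; rewrite addn2; apply: (step_push Hc _ E0 E1 _).
- move=> i s iW pc c /code_at_cons [lt0 E0 _] Hc.
  by exists 1 => //=; rewrite addn1; apply: (step_pop Hc _ E0 _ _ _).
- move=> P Q s1 s2 s3 t1 t2 _ IH1 _ IH2; rewrite geq_max => /andP[WP WQ] pc c.
  move=> /code_at_cat [cP]; rewrite size_compile => cQ Hc.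
  have [n1 n1t H1] := IH1 WP _ _ cP Hc.
  have [n2 n2t H2] := IH2 WQ _ _ cQ H1.
  by exists (n2 + n1); [lia | rewrite iterD addnA].
- move=> i P Q R s s' t _ IH; rewrite !geq_max => /and4P[Wi WP WQ WR] pc c ca.
  have le_end := code_at_size (P := Case i P Q R) ca.
  move: ca; set fin := pc + _ => /code_at_cons [lt0 E0].
  move=> /code_at_cat [cP]; rewrite size_compile => /code_at_cons [ltj Ej].
  move=> /code_at_cat [cQ]; rewrite size_compile => /code_at_cons [ltj' Ej' cR] Hc.
  have endjmp c' pc' : represents c' pc' s' -> pc' < size code ->
      nth (jump 0) code pc' = jump fin -> represents (step c') fin s'.
    by move=> Hc' lt' E'; apply: (step_stay Hc' lt' E' _ erefl erefl le_end).
  case Es : (s i) IH => [|[] w] IH.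
  + have Hb : represents (step c) pc.+1 s.
      by apply: (step_stay Hc lt0 E0 Wi erefl _ _); rewrite ?Es.
    have [n nt Hn] := IH WP _ _ cP Hb.
    exists n.+2; first lia.
    by rewrite iterS iterSr; apply: endjmp Hn _ _; rewrite ?Ej.
  + have Hb : represents (step c) (pc.+2 + clen P) s.
      by apply: (step_stay Hc lt0 E0 Wi erefl _ _); rewrite ?Es //; lia.
    have [n nt Hn] := IH WQ _ _ cQ Hb.
    exists n.+2; first lia.
    by rewrite iterS iterSr; apply: endjmp Hn _ _; rewrite ?Ej'.
  (* The last branch falls through to the end of the [Case], without a final jump. *)
  + have Eq : (pc.+2 + clen P + clen Q).+1 = pc.+3 + clen P + clen Q by lia.
    have Hb : represents (step c) (pc.+3 + clen P + clen Q) s.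
      by apply: (step_stay Hc lt0 E0 Wi erefl _ _); rewrite ?Es //; lia.
    rewrite Eq in cR.
    have [n nt Hn] := IH WR _ _ cR Hb.
    exists n.+1; first lia.
    by rewrite iterSr; move: Hn; congr represents; rewrite /fin; lia.
- move=> i P Q s Es; rewrite !geq_max => /and3P[Wi WP WQ] pc c ca Hc.
  have le_end := code_at_size (P := While i P Q) ca.
  have [lt0 E0 _] := code_at_cons ca.
  by exists 1 => //=; apply: (step_stay Hc lt0 E0 Wi erefl _ le_end); rewrite Es.
- move=> i P Q s s' s'' b w t t' Es _ IH1 _ IH2 W3 pc c ca Hc.
  move: (W3); rewrite !geq_max => /and3P[Wi WP WQ].
  have le_end := code_at_size (P := While i P Q) ca.
  move: (ca) => /code_at_cons [lt0 E0].
  move=> /code_at_cat [cP]; rewrite size_compile => /code_at_cons [ltj Ej].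
  move=> /code_at_cat [cQ]; rewrite size_compile => /code_at_cons [ltj' Ej' _].
  have back c' pc' : represents c' pc' s' -> pc' < size code ->
      nth (jump 0) code pc' = jump pc -> represents (step c') pc s'.
    by move=> Hc' lt' E'; apply: (step_stay Hc' lt' E' _ erefl erefl (ltnW lt0)).
  suff [n nt Hn] : exists2 n, n <= t + 2 &
      represents (iter n (@step _ prog_machine) c) pc s'.
    have [n' nt' Hn'] := IH2 W3 _ _ ca Hn.
    by exists (n' + n); [lia | rewrite iterD].
  have Hb pc' : pc' = (if b then pc.+1 else pc.+2 + clen P) ->
      represents (step c) pc' (upd s i w).
    move=> Epc; have -> : w = behead (s i) by rewrite Es.
    apply: (step_pop Hc lt0 E0 Wi _ _); first by rewrite Es Epc; case: b {Es IH1 Epc}.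
    by rewrite Epc; case: b {Es IH1 Epc}; lia.
  case: b Es IH1 Hb => Es IH1 Hb.
  + have [n nt Hn] := IH1 WP _ _ cP (Hb _ erefl).
    exists n.+2; first lia.
    by rewrite iterS iterSr; apply: back Hn _ _; rewrite ?Ej.
  + have [n nt Hn] := IH1 WQ _ _ cQ (Hb _ erefl).
    exists n.+2; first lia.
    by rewrite iterS iterSr; apply: back Hn _ _; rewrite ?Ej'.
- move=> P s s' t t' _ IH tt' WP pc c ca Hc.
  by have [n nt Hn] := IH WP _ _ ca Hc; exists n => //; lia.
Qed.

Lemma iter_step_halting (c : config prog_machine) n :
  halting c.1 -> iter n (@step _ prog_machine) c = c.
Proof. by move=> Hc; elim: n => //= n ->; rewrite /step Hc. Qed.

Lemma leading_bits_stack w k :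
  leading_bits (M := prog_machine) ([seq Some (inl b) | b <- w] ++ nseq k None) = w.
Proof. by elim: w => [|b w /= ->] //; case: k. Qed.

Lemma exec_outputs_within (args : r.-tuple word) s' t :
  exec prog (nth [::] ([::] :: args)) s' t ->
  outputs_within prog_machine t args (s' 0).
Proof.
move=> E.
have code0 : code_at 0 (compile prog 0) by exists [::], [::]; rewrite cats0.
have Hi : represents (init_config prog_machine args) 0 (nth [::] ([::] :: args)).
  split=> // x; rewrite /init_config /= ffunE; case: x => [[i|j]|] /=.
  - by rewrite (tnth_nth [::]); split; exists 0; rewrite ?cats0.
  - rewrite addnS /= nth_default ?size_tuple ?leq_addr //.
    by split; exists 0.
  - by split; exists 0.
have [n nt [H1 H2]] := exec_represents E (leqnn _) code0 Hi.
(* The machine may stop early; a halted configuration is a fixed point, so the remaining [t - n]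
   steps are idle. *)
rewrite /outputs_within -(subnK nt) iterD.
set c := iter n _ _ in H1 H2 *.
have hc : halting c.1.
  by apply/eqP; rewrite /= H1 size_compile.
rewrite iter_step_halting //; split=> //.
by rewrite /output; have [_ [k ->]] := H2 None; rewrite leading_bits_stack.
Qed.

End Compile.

Lemma exec_poly_time r (f : r.-tuple word -> word) (P : cmd) (q : {poly nat}) :
  (forall args : r.-tuple word, exists2 s',
     exec P (nth [::] ([::] :: args)) s' q.[(\sum_(i < r) size (tnth args i))%N]%R &
     s' 0 = f args) ->
  poly_time f.
Proof.
move=> H; exists (prog_machine r P), q => args.
by have [s' E <-] := H args; apply: exec_outputs_within.
Qed.

(** * Polynomial bounds *)

Definition poly_bounded (f : nat -> nat) :=
  exists q : {poly nat}, forall n, f n <= q.[n]%R.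

(** Coefficients are natural numbers, so majorants are monotone even if the bounded functions are
    not; composing bounds rests on this. *)
Lemma horner_nat_mono (q : {poly nat}) n m : n <= m -> q.[n]%R <= q.[m]%R.
Proof.
move=> nm; rewrite /horner; elim: (polyseq q) => //= a s IH.
by apply: leq_add => //; apply: leq_mul.
Qed.

Lemma poly_bounded_horner (q : {poly nat}) : poly_bounded (fun n => q.[n]%R).
Proof. by exists q. Qed.

Lemma poly_bounded_const c : poly_bounded (fun _ => c).
Proof. by exists (c%:P)%R => n; rewrite hornerC. Qed.

Lemma poly_bounded_id : poly_bounded id.
Proof. by exists 'X%R => n; rewrite hornerX. Qed.

Lemma poly_bounded_add f g :
  poly_bounded f -> poly_bounded g -> poly_bounded (fun n => f n + g n).
Proof.
move=> [p Hp] [q Hq]; exists (p + q)%R => n; rewrite hornerD.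
exact: leq_add.
Qed.

Lemma poly_bounded_succ f : poly_bounded f -> poly_bounded (fun n => (f n).+1).
Proof.
move=> Hf; have [q Hq] := poly_bounded_add Hf (poly_bounded_const 1).
by exists q => n; rewrite -addn1.
Qed.

Lemma poly_bounded_mul f g :
  poly_bounded f -> poly_bounded g -> poly_bounded (fun n => f n * g n).
Proof.
move=> [p Hp] [q Hq]; exists (p * q)%R => n; rewrite hornerM.
exact: leq_mul.
Qed.

Lemma poly_bounded_comp f g :
  poly_bounded f -> poly_bounded g -> poly_bounded (fun n => f (g n)).
Proof.
move=> [p Hp] [q Hq]; exists (p \Po q)%R => n; rewrite horner_comp.
by apply: leq_trans (Hp _) _; apply: horner_nat_mono.
Qed.

Ltac poly_bounded_tac :=
  repeat first [ assumption | lazymatch goal with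
    | |- poly_bounded (fun n => @?f n + @?g n) => apply: (@poly_bounded_add f g)
    | |- poly_bounded (fun n => @?f n * @?g n) => apply: (@poly_bounded_mul f g)
    | |- poly_bounded (fun n => (@?f n).+1) => apply: (@poly_bounded_succ f)
    | |- poly_bounded (fun n => n) => exact: poly_bounded_id
    | |- poly_bounded (fun _ => ?c) => exact: (poly_bounded_const c)
    | |- poly_bounded (fun n => ?q.[n]%R) => exact: poly_bounded_horner
    end ].

(** * Program library *)

Lemma updxx s i w : upd s i w i = w.
Proof. by rewrite /upd eqxx. Qed.

Lemma upd_neq s i j w : j != i -> upd s i w j = s j.
Proof. by rewrite /upd => /negPf ->. Qed.

Ltac store_ext :=
  apply: functional_extensionality => ?; rewrite /upd;
  repeat case: eqP => ? //; subst => //; try congruence.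

Lemma exec_ext P s s1 s2 t : exec P s s1 t -> s1 = s2 -> exec P s s2 t.
Proof. by move=> + <-. Qed.

Lemma exec_cast P s s1 s2 t t' :
  exec P s s1 t -> s1 = s2 -> t <= t' -> exec P s s2 t'.
Proof. by move=> E <-; apply: ExecWeaken. Qed.

(** Concrete stores are lists read by [nth], so that updates compute and stores can be compared by
    conversion. *)
Lemma upd_nth l i w : upd (nth [::] l) i w = nth [::] (set_nth [::] l i w).
Proof. by apply: functional_extensionality => k; rewrite nth_set_nth. Qed.

Lemma exec_while_nth i P l b w s s' t t' : nth [::] l i = b :: w ->
  exec P (nth [::] (set_nth [::] l i w)) s t -> exec (While i P P) s s' t' ->
  exec (While i P P) (nth [::] l) s' (t + 2 + t').
Proof.
by move=> E EP EW; apply: ExecWhileCons E _ EW; rewrite if_same upd_nth.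
Qed.

Lemma nth_cat_nseq (l : seq word) k : nth [::] (l ++ nseq k [::]) = nth [::] l.
Proof.
apply: functional_extensionality => i; rewrite nth_cat nth_nseq.
by case: ltnP => // ?; rewrite if_same nth_default.
Qed.

Definition clear i := While i Skip Skip.

Lemma exec_clear i s : exec (clear i) s (upd s i [::]) (2 * size (s i) + 1).
Proof.
move E: (s i) => w; elim: w s E => [|b w IH] s E.
  by apply: exec_ext (ExecWhileNil _ _ E) _; store_ext.
apply: exec_cast (ExecWhileCons (t := 0) E _ (IH (upd s i w) _)) _ _.
- by case: b {E}; apply: ExecSkip.
- by rewrite updxx.
- by store_ext.
- by rewrite /=; lia.
Qed.

Definition transfer i j := While i (Push j true) (Push j false).

Lemma exec_transfer i j s : i != j ->
  exec (transfer i j) s (upd (upd s i [::]) j (catrev (s i) (s j)))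
    (4 * size (s i) + 1).
Proof.
move=> ij; move E: (s i) => w; elim: w s E => [|b w IH] s E.
  by apply: exec_ext (ExecWhileNil _ _ E) _; store_ext.
apply: exec_cast (ExecWhileCons (s' := upd (upd s i w) j (b :: s j)) (t := 2) E _
   (IH _ _)) _ _.
- have -> : s j = upd s i w j by rewrite upd_neq // eq_sym.
  by case: b {E}; apply: ExecPush.
- by rewrite upd_neq // updxx.
- by rewrite updxx; store_ext.
- by rewrite /=; lia.
Qed.

Lemma nseq_cat_cons (T : Type) n (b : T) s : nseq n b ++ b :: s = b :: nseq n b ++ s.
Proof. by elim: n => //= n ->. Qed.

(** A stack can be traversed only by emptying it. Pouring [i] into [k] and back reverses it twice,
    and the way back leaves one unit on [j] per bit. *)
Definition restore_count k i j :=
  While k (Seq (Push i true) (Push j true)) (Seq (Push i false) (Push j true)).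

Lemma exec_restore_count k i j s : uniq [:: k; i; j] ->
  exec (restore_count k i j) s
    (upd (upd (upd s k [::]) i (catrev (s k) (s i))) j
         (nseq (size (s k)) true ++ s j))
    (6 * size (s k) + 1).
Proof.
rewrite /= !inE negb_or => /and3P[/andP[ki kj] ij _].
have ik : i != k by rewrite eq_sym.
have jk : j != k by rewrite eq_sym.
have ji : j != i by rewrite eq_sym.
move E: (s k) => w; elim: w s E => [|b w IH] s E.
  by apply: exec_ext (ExecWhileNil _ _ E) _; store_ext.
apply: exec_cast (ExecWhileCons
  (s' := upd (upd (upd s k w) i (b :: s i)) j (true :: s j)) (t := 4) E _
  (IH _ _)) _ _.
- have -> : s j = upd (upd s k w) i (b :: s i) j by rewrite !upd_neq.
  have -> : s i = upd s k w i by rewrite !upd_neq.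
  by case: b {E}; apply: (ExecSeq (ExecPush _ _ _) (ExecPush _ _ _)).
- by rewrite 2?upd_neq // updxx.
- by rewrite updxx (upd_neq _ _ ij) updxx /= nseq_cat_cons; store_ext.
- by rewrite /=; lia.
Qed.

Definition count i j k := Seq (transfer i k) (restore_count k i j).

Lemma exec_count i j k s : uniq [:: k; i; j] -> s k = [::] ->
  exec (count i j k) s (upd s j (nseq (size (s i)) true ++ s j))
    (10 * size (s i) + 2).
Proof.
move=> U Ek; have := U; rewrite /= !inE negb_or => /and3P[/andP[ki kj] ij _].
have ik : i != k by rewrite eq_sym.
have ji : j != i by rewrite eq_sym.
have jk : j != k by rewrite eq_sym.
apply: exec_cast (ExecSeq (exec_transfer s ik) (exec_restore_count _ U)) _ _.
- rewrite updxx (upd_neq _ _ ik) updxx !upd_neq // Ek -/(rev _) size_rev.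
  by rewrite -/(rev _) revK; store_ext.
- by rewrite updxx Ek -/(rev _) size_rev; lia.
Qed.

Fixpoint push_ones c i := if c is c'.+1 then Seq (Push i true) (push_ones c' i) else Skip.

Lemma exec_push_ones c i s :
  exec (push_ones c i) s (upd s i (nseq c true ++ s i)) (2 * c).
Proof.
elim: c s => [|c IH] s /=.
  by apply: exec_ext (ExecSkip _) _; store_ext.
apply: exec_cast (ExecSeq (ExecPush _ _ _) (IH _)) _ _; last by lia.
by rewrite updxx nseq_cat_cons; store_ext.
Qed.

(* Horner's scheme in unary: [r := r * a + c] for each coefficient [c], with
   [w] and [k] as scratch registers. *)
Fixpoint unary_horner (cs : seq nat) (a r w k : nat) : cmd :=
  if cs is c :: cs' then
    Seq (unary_horner cs' a r w k)
   (Seq (While r (count a w k) (count a w k))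
   (Seq (transfer w r) (push_ones c r)))
  else Skip.

Lemma catrev_nseq (T : Type) n (b : T) s : catrev (nseq n b) s = nseq n b ++ s.
Proof. by elim: n s => //= n IH s; rewrite IH nseq_cat_cons. Qed.

Lemma nseq_cat_cat (T : Type) n m (b : T) s :
  nseq n b ++ nseq m b ++ s = nseq (n + m) b ++ s.
Proof. by rewrite nseqD catA. Qed.

Lemma exec_unary_mul a r w k s n : uniq [:: k; a; w; r] ->
  s r = nseq n true -> s k = [::] ->
  exec (While r (count a w k) (count a w k)) s
    (upd (upd s r [::]) w (nseq (n * size (s a)) true ++ s w))
    (n * (10 * size (s a) + 4) + 1).
Proof.
rewrite /= !inE !negb_or => /and4P[/and3P[ka kw kr] /andP[aw ar] wr _].
elim: n s => [|n IH] s Er Ek.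
  by rewrite /= in Er; apply: exec_ext (ExecWhileNil _ _ Er) _; store_ext.
have U : uniq [:: k; a; w] by rewrite /= !inE negb_or ka kw aw.
have E1 := exec_count (s := upd s r (nseq n true)) U _.
rewrite !upd_neq // in E1; have {}E1 := E1 Ek.
have wr' : r != w by rewrite eq_sym.
apply: exec_cast (ExecWhileCons Er E1 (IH _ _ _)) _ _.
- by rewrite upd_neq // updxx.
- by rewrite !upd_neq.
- rewrite updxx !upd_neq // nseq_cat_cat mulSn addnC; store_ext.
- by rewrite !upd_neq //; lia.
Qed.

Lemma exec_unary_horner cs a r w k : uniq [:: k; a; w; r] ->
  exists2 T, poly_bounded T & forall s,
    s r = [::] -> s w = [::] -> s k = [::] ->
    exec (unary_horner cs a r w k) s
      (upd s r (nseq (horner_rec cs (size (s a))) true)) (T (size (s a))).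
Proof.
move=> U; have := U.
rewrite /= !inE !negb_or => /and4P[/and3P[ka kw kr] /andP[aw ar] wr _].
have rw : r != w by rewrite eq_sym.
elim: cs => [|c cs [T pT IH]].
  exists (fun=> 0); first exact: poly_bounded_const.
  by move=> s Er Ew Ek; apply: exec_ext (ExecSkip _) _; store_ext.
pose H n := horner_rec cs n.
have pH : poly_bounded H.
  by exists (Poly cs) => n; rewrite horner_Poly.
exists (fun n => T n + (H n * (10 * n + 4) + 1 + ((4 * (H n * n) + 1) + 2 * c))).
  by poly_bounded_tac.
move=> s Er Ew Ek; have E1 := IH s Er Ew Ek.
have E2 := exec_unary_mul (s := upd s r (nseq (H (size (s a))) true)) U (updxx _ _ _) _.
rewrite !upd_neq // Ew cats0 in E2; have {}E2 := E2 Ek.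
have E3 := exec_transfer
  (upd (upd (upd s r (nseq (H (size (s a))) true)) r [::]) w
     (nseq (H (size (s a)) * size (s a)) true)) wr.
rewrite updxx (upd_neq _ _ rw) updxx size_nseq in E3.
apply: exec_cast (ExecSeq E1 (ExecSeq E2 (ExecSeq E3 (exec_push_ones _ _ _)))) _ _.
  rewrite updxx catrev_nseq nseq_cat_cat !cats0 addnC.
  by store_ext.
by rewrite /H; lia.
Qed.

(** * Emitting formulas *)

(* A template is a formula in whose variable names the contents of registers
   can be inserted. *)
Inductive item := Bit of bool | Reg of nat.
Definition template := seq (seq (bool * seq item)).

Definition item_word (s : store) (it : item) : word :=
  match it with Bit b => [:: b] | Reg i => s i end.

Definition expand_name (s : store) (its : seq item) : word :=
  flatten [seq item_word s it | it <- its].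

Definition expand_literal (s : store) (l : bool * seq item) : literal :=
  (l.1, expand_name s l.2).

Definition expand (s : store) (C : template) : cnf :=
  [seq [seq expand_literal s l | l <- c] | c <- C].

Section Emit.
Variables (k : nat) (rs : seq nat).

Definition item_ok (it : item) := if it is Reg i then i \in rs else true.
Definition template_ok (C : template) :=
  all (all (fun l : bool * seq item => all item_ok l.2)) C.

Definition emit_bit b := Seq (Push 0 b) (Push 0 false).

(* The output register is a stack, so everything is emitted from the right. *)
Definition emit_item (it : item) : cmd :=
  match it with
  | Bit b => emit_bit b
  | Reg i => Seq (transfer i k)
      (While k (Seq (Push i true) (emit_bit true)) (Seq (Push i false) (emit_bit false)))
  end.

Definition emit_seq (T : Type) (f : T -> cmd) (xs : seq T) : cmd :=
  foldr (fun x P => Seq P (f x)) Skip xs.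

Definition emit_literal (l : bool * seq item) : cmd :=
  Seq (emit_seq emit_item l.2)
      (Seq (emit_bit l.1) (Seq (Push 0 false) (Push 0 true))).

Definition emit_clause (c : seq (bool * seq item)) : cmd :=
  Seq (emit_seq emit_literal c) (Seq (Push 0 true) (Push 0 true)).

Definition emit (C : template) : cmd := emit_seq emit_clause C.

(** The constant [c] depends on the program alone, so printing costs linear time in the inserted
    registers; these survive, since only register 0 changes. *)
Definition emits (P : cmd) (w : store -> word) :=
  exists c, forall s N, s k = [::] -> (forall i, i \in rs -> size (s i) <= N) ->
    exec P s (upd s 0 (w s ++ s 0)) (c * N.+1).

(** The second command of a sequence runs with the first output already in register 0, and its own
    text must not depend on that. *)
Definition output_free (w : store -> word) :=
  forall s v, w (upd s 0 v) = w s.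

Lemma emits_case i P Q R u v w : emits P u -> emits Q v -> emits R w ->
  emits (Case i P Q R)
    (fun s => if s i is b :: _ then if b then v s else w s else u s).
Proof.
move=> [a Ha] [b Hb] [c Hc]; exists (a + b + c + 2) => s N Ek Hs.
apply: ExecWeaken (_ : a * N.+1 + b * N.+1 + c * N.+1 + 2 <= _); last by lia.
apply: ExecCase; case: (s i) => [|[] _].
- by apply: ExecWeaken (Ha s N Ek Hs) _; lia.
- by apply: ExecWeaken (Hb s N Ek Hs) _; lia.
- by apply: ExecWeaken (Hc s N Ek Hs) _; lia.
Qed.

Hypotheses (k0 : k != 0) (krs : k \notin rs) (rs0 : 0 \notin rs).

Lemma emits_skip : emits Skip (fun=> [::]).
Proof.
by exists 0 => s N _ _; apply: exec_cast (ExecSkip _) _ _ => //; store_ext.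
Qed.

Lemma emits_push b : emits (Push 0 b) (fun=> [:: b]).
Proof.
by exists 2 => s N _ _; apply: exec_cast (ExecPush _ _ _) _ _ => //; lia.
Qed.

Lemma emits_seq P Q w v : emits P w -> emits Q v -> output_free v ->
  emits (Seq P Q) (fun s => v s ++ w s).
Proof.
move=> [c Hc] [d Hd] fv; exists (c + d) => s N Ek Hs.
rewrite mulnDl; apply: exec_ext (ExecSeq (Hc s N Ek Hs) (Hd _ N _ _)) _.
- by rewrite upd_neq.
- move=> i irs; rewrite upd_neq ?Hs //.
  by apply: contraNneq rs0 => <-.
- by rewrite updxx fv catA; store_ext.
Qed.

Lemma emits_ext P w v : emits P w -> w =1 v -> emits P v.
Proof. by move=> [c H] E; exists c => s N Ek Hs; rewrite -E; apply: H. Qed.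

Lemma emits_bit b : emits (emit_bit b) (fun=> [:: false; b]).
Proof.
by apply: (@emits_seq _ _ (fun=> [:: b]) (fun=> [:: false])) => //; apply: emits_push.
Qed.

Lemma encode_bits_cat u v : encode_bits (u ++ v) = encode_bits u ++ encode_bits v.
Proof. by rewrite /encode_bits map_cat flatten_cat. Qed.

(** Here [k] holds register [i] reversed, so its bits come off last to first, the order in which a
    stack must receive them; the same pass rebuilds [i]. *)
Lemma exec_emit_restore i s : i != k -> i != 0 ->
  exec (While k (Seq (Push i true) (emit_bit true)) (Seq (Push i false) (emit_bit false)))
    s (upd (upd (upd s k [::]) i (catrev (s k) (s i))) 0
        (encode_bits (rev (s k)) ++ s 0)) (8 * size (s k) + 1).
Proof.
move=> ik i0; move E: (s k) => w; elim: w s E => [|b w IH] s E.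
  by apply: exec_ext (ExecWhileNil _ _ E) _; store_ext.
have ki : k != i by rewrite eq_sym.
have z0 : 0 != i by rewrite eq_sym.
have zk : 0 != k by rewrite eq_sym.
apply: exec_cast (ExecWhileCons (t := 6)
  (s' := upd (upd (upd s k w) i (b :: s i)) 0 (false :: b :: s 0)) E _ (IH _ _)) _ _.
- have -> : upd (upd (upd s k w) i (b :: s i)) 0 (false :: b :: s 0) =
     upd (upd (upd (upd s k w) i (b :: upd s k w i)) 0 (b :: s 0)) 0 (false :: b :: s 0).
    by rewrite upd_neq //; store_ext.
  have E0 : upd (upd s k w) i (b :: upd s k w i) 0 = s 0 by rewrite !upd_neq.
  rewrite -E0; set u := upd (upd s k w) i _.
  have -> : upd (upd u 0 (b :: u 0)) 0 (false :: b :: u 0) =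
            upd (upd u 0 (b :: u 0)) 0 (false :: upd u 0 (b :: u 0) 0) by rewrite updxx.
  by rewrite /u; case: b {E E0 u}; apply: (ExecSeq (t1 := 2) (t2 := 4));
    do ?[apply: ExecPush | apply: (ExecSeq (t1 := 2) (t2 := 2))].
- by rewrite 2?upd_neq // updxx.
- rewrite updxx (upd_neq _ _ i0) updxx rev_cons -cats1 encode_bits_cat -catA /=.
  by store_ext.
- by rewrite /=; lia.
Qed.

Lemma emits_item it : item_ok it ->
  emits (emit_item it) (fun s => encode_bits (item_word s it)).
Proof.
case: it => [b|i] /= ok; first exact: emits_bit.
have ik : i != k by apply: contraTneq ok => ->.
have i0 : i != 0 by apply: contraTneq ok => ->.
have ki : k != i by rewrite eq_sym.
have z0 : 0 != i by rewrite eq_sym.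
have zk : 0 != k by rewrite eq_sym.
exists 12 => s N Ek Hs.
apply: exec_cast (ExecSeq (exec_transfer _ ik) (exec_emit_restore _ ik i0)) _ _.
- rewrite updxx Ek (upd_neq _ _ ik) updxx 2?upd_neq //.
  by rewrite -/(rev _) -/(rev _) revK; store_ext.
- by rewrite updxx Ek -/(rev _) size_rev; have := Hs i ok; lia.
Qed.

Lemma emits_emit_seq (T : Type) (f : T -> cmd) (w : T -> store -> word)
    (ok : pred T) xs :
  (forall x, ok x -> emits (f x) (w x) /\ output_free (w x)) -> all ok xs ->
  emits (emit_seq f xs) (fun s => flatten [seq w x s | x <- xs]) /\
  output_free (fun s => flatten [seq w x s | x <- xs]).
Proof.
move=> H; elim: xs => [|x xs IH] /=; first by split; [exact: emits_skip|].
move=> /andP[/H [ex fx] /IH [exs fxs]]; split; first exact: emits_seq.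
by move=> s v; rewrite fx fxs.
Qed.

Lemma flatten_encode_bits (ws : seq word) :
  flatten [seq encode_bits w | w <- ws] = encode_bits (flatten ws).
Proof. by elim: ws => //= w ws ->; rewrite encode_bits_cat. Qed.

Lemma emits_literal l : all item_ok l.2 ->
  emits (emit_literal l) (fun s => encode_literal (expand_literal s l)) /\
  output_free (fun s => encode_literal (expand_literal s l)).
Proof.
move=> ok; have [|e f] := @emits_emit_seq _ emit_item
  (fun it s => encode_bits (item_word s it)) item_ok l.2 _ ok.
  move=> it /= okit; split; first exact: emits_item.
  case: it okit => [b|i] //= irs s v; rewrite upd_neq //.
  by apply: contraTneq irs => ->.
have E s : flatten [seq encode_bits (item_word s it) | it <- l.2] =
    encode_bits (expand_name s l.2).
  by rewrite -flatten_encode_bits -map_comp.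
split; last first.
  by move=> s v; have := f s v; rewrite !E => H; congr [:: true, false, false, l.1 & _].
apply: emits_ext (emits_seq e (emits_seq (emits_bit l.1)
  (emits_seq (emits_push false) (emits_push true) _) _) _) _ => //.
by move=> s; rewrite E.
Qed.

Lemma emits_emit C : template_ok C -> emits (emit C) (fun s => encode (expand s C)).
Proof.
move=> ok; have [|e _] := @emits_emit_seq _ emit_clause
  (fun c s => encode_clause [seq expand_literal s l | l <- c]) _ C _ ok.
  move=> c okc; have [|e f] := @emits_emit_seq _ emit_literal
    (fun l s => encode_literal (expand_literal s l)) _ c _ okc.
    exact: emits_literal.
  split; last by move=> s v; have := f s v; rewrite /encode_clause -!map_comp => ->.
  apply: emits_ext (emits_seq e (emits_seq (emits_push true) (emits_push true) _) _) _ => //.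
  by move=> s; rewrite /encode_clause -map_comp.
by apply: emits_ext e _ => s; rewrite /encode /expand -map_comp.
Qed.

End Emit.

(** * Counting satisfying assignments *)

(** The domain of an [assignment] depends on the formula; a valuation of all words can be tested on
    each part of a formula separately. *)
Definition sat (v : variable -> bool) (phi : cnf) : bool :=
  all (has (fun l : literal => v l.2 == l.1)) phi.

Lemma vars_mem (phi : cnf) (c : clause) (l : literal) :
  c \in phi -> l \in c -> l.2 \in vars phi.
Proof.
by move=> cphi lc; rewrite mem_undup map_f //; apply/flattenP; exists c.
Qed.

Lemma eq_sat (u v : variable -> bool) (phi : cnf) :
  {in vars phi, u =1 v} -> sat u phi = sat v phi.
Proof.
move=> E; apply: eq_in_all => c cphi; apply: eq_in_has => l lc /=.
by rewrite E // (vars_mem cphi lc).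
Qed.

Lemma value_mem (phi : cnf) (a : assignment phi) (w : seq_sub (vars phi)) :
  value a (val w) = a w.
Proof. by rewrite /value valK. Qed.

(** Parsimony in abstract form. The first two hypotheses make [y] recoverable from the assignment
    that [ext y] induces; the third says that a model is determined by its values on the witness
    variables, so every model arises in this way. *)
Lemma num_sat_card (phi : cnf) m (yv : 'I_m -> variable) (Q : pred (m.-tuple bool))
    (ext : m.-tuple bool -> variable -> bool) :
  (forall i, yv i \in vars phi) ->
  (forall y i, ext y (yv i) = tnth y i) ->
  (forall v, sat v phi ->
     {in vars phi, v =1 ext [tuple v (yv i) | i < m]}) ->
  (forall y, sat (ext y) phi = Q y) ->
  num_sat phi = #|[set y | Q y]|.
Proof.
move=> yvars exty forced satQ.
pose h (y : m.-tuple bool) : assignment phi := [ffun w => ext y (val w)].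
have valh y : {in vars phi, value (h y) =1 ext y}.
  move=> w ww; rewrite -[w]/(val (SeqSub ww)) value_mem ffunE //.
have hinj : injective h.
  move=> y y' E; apply: eq_from_tnth => i.
  by rewrite -!exty -!valh // E.
rewrite -(card_imset _ hinj); congr #|pred_of_set _|.
apply/setP => a; rewrite inE -[satisfies a]/(sat (value a) phi).
apply/idP/imsetP => [Sa|[y]].
  exists [tuple value a (yv i) | i < m].
    rewrite inE -satQ -(eq_sat (u := value a)) //; exact: forced.
  by apply/ffunP => w; rewrite ffunE -(forced _ Sa (val w) (ssvalP w)) value_mem.
by rewrite inE -satQ => Sy ->; rewrite (eq_sat (valh y)).
Qed.

(** * The tableau formula *)

(** Unary fields allow a program to build names by copying its unary counters. *)
Definition vname (t j k : nat) : variable :=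
  nseq t true ++ false :: nseq j true ++ false :: nseq k true.

Definition vname_parse (w : variable) : nat * nat * nat :=
  let t := find negb w in
  let w' := drop t.+1 w in
  let j := find negb w' in
  (t, j, size (drop j.+1 w')).

Lemma vnameK t j k : vname_parse (vname t j k) = (t, j, k).
Proof.
have fE n w : find negb (nseq n true ++ false :: w) = n.
  by elim: n => //= n ->.
have dE n w : drop n.+1 (nseq n true ++ false :: w) = w.
  by elim: n => /= [|n ->] //; rewrite drop0.
by rewrite /vname_parse /vname !fE !dE fE dE size_nseq.
Qed.

(* The order is reversed because formulas are emitted from the right. *)
Fixpoint segments (C : nat -> cnf) (j n : nat) : cnf :=
  if n is n'.+1 then segments C j.+1 n' ++ C j else [::].

Lemma segmentsP C j n c :
  reflect (exists2 i, j <= i < j + n & c \in C i) (c \in segments C j n).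
Proof.
elim: n j => [|n IH] j /=.
  by constructor => -[i]; lia.
rewrite mem_cat; apply: (iffP orP) => [[/IH [i ij ci]|cj]|[i ij ci]].
- by exists i => //; lia.
- by exists j => //; lia.
- case: (ltnP j i) => ji; first by left; apply/IH; exists i => //; lia.
  by right; have <- : i = j by lia.
Qed.

Section Tableau.
Variables (Col : finType) (next : Col -> Col -> Col -> Col -> Col).
Variables (col0 : bool -> option bool -> option bool -> Col) (accepting : pred Col).

Let K := #|Col|.
Definition idx (a : Col) : nat := enum_rank a.

Section Shapes.
Variable N : Type.

(** Names are abstract so that one shape gives both the clauses and the templates printing them. A
    literal with a computed sign such as [a == col0 z xs None] pins its variable to that truth
    value; the literal with sign [~~ bk.1] restricts this to one value of the witness bit. *)
Definition init_shape (yn : N) (vn : nat -> N) (z : bool) (xs : option bool)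
    (hasy : bool) : seq (seq (bool * N)) :=
  if hasy then
    [seq [:: (~~ bk.1, yn); (bk.2 == col0 z xs (Some bk.1), vn (idx bk.2))]
       | bk <- enum {: bool * Col}]
  else [seq [:: (a == col0 z xs None, vn (idx a))] | a <- enum Col].

(** The four negative literals are the premises of an implication; a combination of columns that
    does not occur satisfies its clause at once. *)
Definition rule_shape (vg vl va vr vn : nat -> N) : seq (seq (bool * N)) :=
  [seq let: (g, l, a, r, b) := q in
       [:: (false, vg (idx g)); (false, vl (idx l)); (false, va (idx a));
           (false, vr (idx r)); (b == next g l a r, vn (idx b))]
     | q <- enum {: Col * Col * Col * Col * Col}].

Definition final_shape (vn : nat -> N) : seq (seq (bool * N)) :=
  [:: [seq (true, vn (idx a)) | a <- enum accepting]].

End Shapes.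

Variables (x : word) (m B : nat).

(** Column values have indices below [K], so the index [K] is free for the witness bit. *)
Definition yname j := vname 0 j K.

Definition init_clauses j :=
  init_shape (yname j) (vname 0 j) (j == 0) (onth x j) (j < m).

Definition rule_clauses t j :=
  rule_shape (vname t 0) (vname t j.-1) (vname t j) (vname t j.+1) (vname t.+1 j).

(** For [j < B - t.+1] the cells [(t, j.+1)] and [(t.+1, j)] both lie in the described triangle. *)
Definition tableau : cnf :=
  final_shape (vname B.-1 0) ++
  segments (fun t => segments (rule_clauses t) 0 (B - t.+1)) 0 B ++
  segments init_clauses 0 B.

Fixpoint row (y : word) (t j : nat) : Col :=
  if t is t'.+1 then next (row y t' 0) (row y t' j.-1) (row y t' j) (row y t' j.+1)
  else col0 (j == 0) (onth x j) (onth y j).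

(** The intended model, defined on all words by parsing the name; an index that is no column value
    is taken to mean a witness bit. *)
Definition row_value (y : word) (w : variable) : bool :=
  let: (t, j, k) := vname_parse w in
  if insub k is Some o then enum_val (o : 'I_K) == row y t j else nth false y j.

Lemma row_value_cell y t j a : row_value y (vname t j (idx a)) = (a == row y t j).
Proof. by rewrite /row_value vnameK /idx valK enum_rankK. Qed.

Lemma row_value_y y j : row_value y (yname j) = nth false y j.
Proof. by rewrite /row_value vnameK insubF ?ltnn. Qed.

Variable v : variable -> bool.
Let y : word := mkseq (fun j => v (yname j)) m.

Definition follows_rows :=
  forall t j, t + j < B -> forall a, v (vname t j (idx a)) = (a == row y t j).

Lemma onth_y j : onth y j = if j < m then Some (v (yname j)) else None.
Proof.
case: ltnP => jm; last by rewrite onth_default // size_mkseq.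
by rewrite onthE (nth_map false) ?size_mkseq // nth_mkseq.
Qed.

Hypothesis B0 : 0 < B.

Lemma sat_init :
  sat v (segments init_clauses 0 B) <->
  forall j, j < B -> forall a, v (vname 0 j (idx a)) = (a == row y 0 j).
Proof.
split=> [/allP S j jB a|H].
  have {}S c : c \in init_clauses j -> has (fun l : literal => v l.2 == l.1) c.
    by move=> cj; apply: S; apply/segmentsP; exists j.
  move: S; rewrite /init_clauses /init_shape /= onth_y; case: ltnP => jm S.
    (* For the bit that [v] really gives to the witness variable, the first literal is false, so the
       second one must hold. *)
    have : has (fun l : literal => v l.2 == l.1) [:: (~~ v (yname j), yname j);
        (a == col0 (j == 0) (onth x j) (Some (v (yname j))), vname 0 j (idx a))].
      by apply: S; apply/mapP; exists (v (yname j), a); rewrite ?mem_enum.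
    by rewrite /= orbF; case: (v (yname j)) => /= /eqP.
  have : has (fun l : literal => v l.2 == l.1)
      [:: (a == col0 (j == 0) (onth x j) None, vname 0 j (idx a))].
    by apply: S; apply/mapP; exists a; rewrite ?mem_enum.
  by rewrite /= orbF => /eqP.
apply/allP => c /segmentsP [j jB].
have {}H := H j jB; move: H; rewrite /init_clauses /init_shape /= onth_y.
case: ltnP => jm H /mapP.
  move=> [[b a] _ ->] /=; rewrite H orbF.
  by case: (v _) b => -[] //=; rewrite eqxx.
by move=> [a _ ->] /=; rewrite H eqxx.
Qed.

Lemma sat_tableau :
  sat v tableau <-> follows_rows /\ accepting (row y B.-1 0).
Proof.
rewrite /tableau {1}/sat !all_cat -!/(sat _ _); split.
  move=> /and3P[Sf /allP Sr /sat_init Si].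
  have F : follows_rows.
    elim=> [|t IH] j tj a; first exact: Si.
    set g := row y t 0; set l := row y t j.-1; set c := row y t j.
    set r := row y t j.+1.
    (* The clause for the columns actually present: by induction its four premises are false
       literals, so the last literal fixes the new cell. *)
    have /Sr : [:: (false, vname t 0 (idx g)); (false, vname t j.-1 (idx l));
        (false, vname t j (idx c)); (false, vname t j.+1 (idx r));
        (a == next g l c r, vname t.+1 j (idx a))] \in
        segments (fun t => segments (rule_clauses t) 0 (B - t.+1)) 0 B.
      apply/segmentsP; exists t; first lia.
      apply/segmentsP; exists j; first lia.
      by apply/mapP; exists (g, l, c, r, a); rewrite ?mem_enum.
    by rewrite /= !IH ?eqxx //= ?orbF; try lia; move/eqP.
  split=> //; move: Sf; rewrite /sat /= andbT => /hasP[l /mapP[a]].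
  rewrite mem_enum => acca -> /=; rewrite F ?eqb_id; last by lia.
  by move=> /eqP <-.
move=> [F acc]; apply/and3P; split.
- rewrite /sat /= andbT; apply/hasP; exists (true, vname B.-1 0 (idx (row y B.-1 0))).
    by apply/mapP; exists (row y B.-1 0); rewrite ?mem_enum.
  by rewrite /= F ?eqxx //; lia.
- apply/allP => c /segmentsP [t tB /segmentsP [j jB /mapP [[[[[g l] a] r] b] _ ->]]] /=.
  rewrite !F; try lia.
  case: (g =P _) => //= ->; case: (l =P _) => //= ->.
  case: (a =P _) => //= ->; case: (r =P _) => //= ->.
  by rewrite eqxx.
- by apply/sat_init => j jB a; apply: F.
Qed.

End Tableau.

(** * Models of the tableau, and templates for its clauses *)

Section TableauTemplates.
Variables (Col : finType) (next : Col -> Col -> Col -> Col -> Col).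
Variables (col0 : bool -> option bool -> option bool -> Col) (accepting : pred Col).

Let K := #|Col|.
Notation row := (row next col0).
Notation row_value := (row_value next col0).

(** For [B = 0] the final clause still mentions column 0 of row 0, which lies outside the empty
    triangle; hence the last alternative. *)
Lemma vars_tableau x m B w : w \in vars (tableau next col0 accepting x m B) ->
  (exists t j (a : Col), t + j < B /\ w = vname t j (idx a)) \/
  (exists2 j, j < m & w = yname Col j) \/ B = 0.
Proof.
case: (posnP B) => B0; first by right; right.
rewrite mem_undup => /mapP [l /flattenP [c]].
rewrite /tableau !mem_cat => /or3P[].
- rewrite inE => /eqP -> /mapP [a _ ->] ->; left.
  by exists B.-1, 0, a; split=> //; lia.
- move=> /segmentsP [t tB /segmentsP [j jB /mapP [[[[[g l'] a] r] b] _ ->]]].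
  rewrite !inE => /or4P[/eqP->|/eqP->|/eqP->|/orP[]/eqP->] -> /=; left.
  + by exists t, 0, g; split=> //; lia.
  + by exists t, j.-1, l'; split=> //; lia.
  + by exists t, j, a; split=> //; lia.
  + by exists t, j.+1, r; split=> //; lia.
  + by exists t.+1, j, b; split=> //; lia.
- move=> /segmentsP [j jB]; rewrite /init_clauses /init_shape; case: ltnP => jm.
    move=> /mapP [[b a] _ ->]; rewrite !inE => /orP[]/eqP-> -> /=.
      by right; left; exists j.
    by left; exists 0, j, a.
  by move=> /mapP [a _ ->]; rewrite !inE => /eqP-> -> /=; left; exists 0, j, a.
Qed.

Lemma num_sat_tableau x m B : 0 < B -> m <= B ->
  num_sat (tableau next col0 accepting x m B) =
    #|[set y : m.-tuple bool | accepting (row x y B.-1 0)]|.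
Proof.
move=> B0 mB.
have tupE (f : nat -> bool) : [tuple f i | i < m] = mkseq f m :> seq bool.
  by rewrite /= /mkseq -val_enum_ord -map_comp.
apply: (@num_sat_card _ _ (fun i : 'I_m => yname Col i) _
  (fun y => row_value x y)).
(* Any column value exhibits a clause of row 0 with the witness variable. The clause is present
   because [i < m <= B]. *)
- move=> i; pose a := col0 true None None.
  apply: (@vars_mem _ [:: (~~ true, yname Col i);
     (a == col0 (i == 0 :> nat) (onth x i) (Some true), vname 0 i (idx a))]
     (~~ true, yname Col i)); last by rewrite inE eqxx.
  rewrite /tableau !mem_cat; apply/or3P/Or33/segmentsP; exists i.
    by rewrite (leq_trans (ltn_ord i)).
  by rewrite /init_clauses ltn_ord; apply/mapP; exists (true, a); rewrite ?mem_enum.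
- by move=> y i; rewrite row_value_y (tnth_nth false).
- move=> v /(sat_tableau _ _ _ _ _ _ B0) [F _] w /vars_tableau [|[|]]; last by lia.
    by move=> [t [j [a [tj ->]]]]; rewrite row_value_cell F //
      (tupE (fun j => v (yname Col j))).
  by move=> [j jm ->]; rewrite row_value_y (tupE (fun j => v (yname Col j))) nth_mkseq.
- move=> y.
  have yE : mkseq (fun j => row_value x y (yname Col j)) m = y.
    apply: (@eq_from_nth _ false); rewrite size_mkseq ?size_tuple // => j jm.
    by rewrite nth_mkseq // row_value_y.
  apply/idP/idP; first by move=> /(sat_tableau _ _ _ _ _ _ B0) [_]; rewrite yE.
  move=> acc; apply/(sat_tableau _ _ _ _ _ _ B0); rewrite yE; split=> //.
  by move=> t j _ a; rewrite row_value_cell yE.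
Qed.

(** Registers 9, 7 and 8 hold [t], [j] and [j.-1] in unary. Successors are made by adding a bit
    [true]; the truncated predecessor cannot be, and so has its own register. *)
Definition cell_items (dt : nat) (pos : seq item) (k : nat) : seq item :=
  Reg 9 :: nseq dt (Bit true) ++ Bit false :: pos ++ Bit false :: nseq k (Bit true).

Definition init_template z xs hy : template :=
  init_shape col0 (cell_items 0 [:: Reg 7] K) (cell_items 0 [:: Reg 7]) z xs hy.

Definition rule_template : template :=
  rule_shape next (cell_items 0 [::]) (cell_items 0 [:: Reg 8])
    (cell_items 0 [:: Reg 7]) (cell_items 0 [:: Reg 7; Bit true])
    (cell_items 1 [:: Reg 7]).

Definition final_template : template := final_shape accepting (cell_items 0 [::]).

Lemma expand_name_cat s u v : expand_name s (u ++ v) = expand_name s u ++ expand_name s v.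
Proof. by rewrite /expand_name map_cat flatten_cat. Qed.

(** An equality of functions of [k], because the shapes take the naming function itself as an
    argument. *)
Lemma expand_cell s t t' j dt pos : s 9 = nseq t true -> t' = t + dt ->
  expand_name s pos = nseq j true ->
  (fun k => expand_name s (cell_items dt pos k)) = vname t' j.
Proof.
have E n : expand_name s (nseq n (Bit true)) = nseq n true by elim: n => //= n <-.
move=> Et -> Ej; apply: functional_extensionality => k.
have C it its : expand_name s (it :: its) = item_word s it ++ expand_name s its by [].
by rewrite /cell_items C expand_name_cat C expand_name_cat C !E Ej /= Et catA -nseqD.
Qed.

Let rs := [:: 7; 8; 9].

Lemma template_ok_init z xs hy : template_ok rs (init_template z xs hy).
Proof.
have E n : all (item_ok rs) (nseq n (Bit true)) by elim: n.
by rewrite /init_template /init_shape; case: hy;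
  rewrite /template_ok all_map; apply/allP => a _ /=; rewrite !E.
Qed.

Lemma template_ok_rule : template_ok rs rule_template.
Proof.
have E n : all (item_ok rs) (nseq n (Bit true)) by elim: n.
rewrite /template_ok all_map; apply/allP => -[[[[g l] a] r] b] _ /=.
by rewrite !E.
Qed.

Lemma template_ok_final : template_ok rs final_template.
Proof.
have E n : all (item_ok rs) (nseq n (Bit true)) by elim: n.
by rewrite /template_ok /= andbT all_map; apply/allP => a _ /=; rewrite !E.
Qed.

Lemma expand_init s j z xs hy : s 9 = [::] -> s 7 = nseq j true ->
  expand s (init_template z xs hy) = init_shape col0 (yname Col j) (vname 0 j) z xs hy.
Proof.
move=> E9 E7; have E := @expand_cell s 0 0 j 0 [:: Reg 7] E9 erefl _.
rewrite {1}/expand_name /= cats0 in E; have {}E := E E7.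
rewrite /yname -E /expand /init_template /init_shape.
by case: hy; rewrite -map_comp.
Qed.

Lemma expand_rule s t j : s 9 = nseq t true -> s 8 = nseq j.-1 true ->
  s 7 = nseq j true -> expand s rule_template = rule_clauses next t j.
Proof.
move=> E9 E8 E7.
rewrite /rule_clauses.
rewrite -(@expand_cell s t t 0 0 [::] E9) ?addn0 //.
rewrite -(@expand_cell s t t j.-1 0 [:: Reg 8] E9 (esym (addn0 t)));
  last by rewrite /expand_name /= cats0.
rewrite -(@expand_cell s t t j 0 [:: Reg 7] E9 (esym (addn0 t)));
  last by rewrite /expand_name /= cats0.
rewrite -(@expand_cell s t t j.+1 0 [:: Reg 7; Bit true] E9 (esym (addn0 t))); last first.
  by rewrite -(addn1 j) nseqD /expand_name /= E7.
rewrite -(@expand_cell s t t.+1 j 1 [:: Reg 7] E9 (esym (addn1 t)));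
  last by rewrite /expand_name /= cats0.
rewrite /expand /rule_template /rule_shape -map_comp.
by apply: eq_map => -[[[[g l] a] r] b].
Qed.

Lemma expand_final s t : s 9 = nseq t true ->
  expand s final_template = final_shape accepting (vname t 0).
Proof.
move=> E9; rewrite -(@expand_cell s t t 0 0 [::] E9) ?addn0 //.
by rewrite /expand /= -map_comp.
Qed.

End TableauTemplates.

Lemma encode_cat phi psi : encode (phi ++ psi) = encode phi ++ encode psi.
Proof. by rewrite /encode map_cat flatten_cat. Qed.

Lemma onth_drop (T : Type) (s : seq T) j : onth s j = ohead (drop j s).
Proof. by elim: s j => [|a s IH] [|j] //=; rewrite IH. Qed.

(** * Writing the tableau in polynomial time *)

Section TableauProgram.
Variables (Col : finType) (next : Col -> Col -> Col -> Col -> Col).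
Variables (col0 : bool -> option bool -> option bool -> Col) (accepting : pred Col).
Let rs := [:: 7; 8; 9].

(* Registers: 0 output, 1 remaining input, 2 [m] and 4 [B] in unary (both counted
   down), 3 argument of the time bound, 5 and 6 scratch, 7 [j], 8 [j.-1], 9 [t],
   10 loop counter. *)

Definition init_by_y z xs :=
  Case 2 (emit 5 (init_template col0 z xs false)) (emit 5 (init_template col0 z xs true))
    (emit 5 (init_template col0 z xs true)).

Definition init_by_x z :=
  Case 1 (init_by_y z None) (init_by_y z (Some true)) (init_by_y z (Some false)).

Definition emit_init := Case 7 (init_by_x true) (init_by_x false) (init_by_x false).

(** Whether [j = 0], which input bit is next and whether a witness bit is present are seen on the
    tops of three stacks; each outcome has a template fixed in advance. *)
Lemma emits_init : emits 5 rs emit_init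
  (fun s => encode (expand s
     (init_template col0 (nilp (s 7)) (ohead (s 1)) (~~ nilp (s 2))))).
Proof.
have E z xs hy := emits_emit (k := 5) (rs := rs) isT isT isT
  (template_ok_init col0 z xs hy).
have Ey z xs := emits_case 2 (E z xs false) (E z xs true) (E z xs true).
have Ex z := emits_case 1 (Ey z None) (Ey z (Some true)) (Ey z (Some false)).
apply: emits_ext (emits_case 7 (Ex true) (Ex false) (Ex false)) _ => s.
by case: (s 7) => [|[] ?]; case: (s 1) => [|[] ?]; case: (s 2) => [|[] ?].
Qed.

Definition init_body := Seq emit_init (Seq (Pop 1) (Seq (Pop 2) (Push 7 true))).

Lemma exec_init_loop : exists c, forall x m j w out nm S N, j + size w <= N ->
  exec (While 10 init_body init_body)
    (nth [::] [:: out; drop j x; nseq (m - j) true; nm; S; [::]; [::];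
                  nseq j true; [::]; [::]; w])
    (nth [::] [:: encode (segments (init_clauses col0 x m) j (size w)) ++ out;
                  drop (j + size w) x; nseq (m - (j + size w)) true; nm; S; [::]; [::];
                  nseq (j + size w) true; [::]; [::]; [::]])
    (size w * (c * N.+1 + 6) + 1).
Proof.
have [c Hc] := emits_init; exists c => x m j w out nm S N.
elim: w j out => [|b w IH] j out jN /=.
  by rewrite addn0; apply: ExecWhileNil.
set l := [:: out; drop j x; nseq (m - j) true; nm; S; [::]; [::];
             nseq j true; [::]; [::]; w].
have Hl i : i \in rs -> size (nth [::] l i) <= N.
  by rewrite !inE => /or3P[]/eqP-> //=; rewrite size_nseq; move: jN => /=; lia.
have E1 := Hc (nth [::] l) N erefl Hl.
rewrite (@expand_init _ _ _ j) //= in E1.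
have Ei : init_shape col0 (yname Col j) (vname 0 j) (nilp (nseq j true))
   (ohead (drop j x)) (~~ nilp (nseq (m - j) true)) = init_clauses col0 x m j.
  rewrite /init_clauses onth_drop /nilp !size_nseq; congr init_shape.
  by rewrite subn_eq0 ltnNge.
rewrite {}Ei upd_nth /= in E1.
have E2 : exec init_body (nth [::] l)
    (nth [::] [:: encode (init_clauses col0 x m j) ++ out; drop j.+1 x;
        nseq (m - j.+1) true; nm; S; [::]; [::]; nseq j.+1 true; [::]; [::]; w])
    (c * N.+1 + 4).
  apply: exec_cast (ExecSeq E1 (ExecSeq (ExecPop _ _) (ExecSeq (ExecPop _ _)
    (ExecPush _ _ _)))) _ _; last by lia.
  rewrite !upd_nth /=; congr (nth _ [:: _, _, _ & _]).
    by rewrite -drop1 drop_drop.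
  by rewrite subnS; case: (m - j).
have jN' : j.+1 + size w <= N by move: jN => /=; lia.
apply: exec_cast; first by apply: exec_while_nth; [| exact: E2 | exact: (IH _ _ jN')].
- by rewrite addSnnS /= encode_cat -catA.
- by lia.
Qed.

(** When [j] grows, [j.-1] grows too, except from [j = 0], where it remains 0. *)
Definition rule_body :=
  Seq (emit 5 (rule_template next))
      (Seq (Case 7 Skip (Push 8 true) (Push 8 true)) (Push 7 true)).

Lemma exec_rule_loop : exists c, forall t j w out x m nm S N,
  t <= N -> j + size w <= N ->
  exec (While 10 rule_body rule_body)
    (nth [::] [:: out; x; m; nm; S; [::]; [::];
                  nseq j true; nseq j.-1 true; nseq t true; w])
    (nth [::] [:: encode (segments (rule_clauses next t) j (size w)) ++ out;
                  x; m; nm; S; [::]; [::];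
                  nseq (j + size w) true; nseq (j + size w).-1 true; nseq t true; [::]])
    (size w * (c * N.+1 + 8) + 1).
Proof.
have [c Hc] := emits_emit (k := 5) (rs := rs) isT isT isT (template_ok_rule next).
exists c => t j w out x m nm S N tN.
elim: w j out => [|b w IH] j out jN /=.
  by rewrite addn0; apply: ExecWhileNil.
set l := [:: out; x; m; nm; S; [::]; [::];
             nseq j true; nseq j.-1 true; nseq t true; w].
have Hl i : i \in rs -> size (nth [::] l i) <= N.
  by rewrite !inE => /or3P[]/eqP-> /=; rewrite size_nseq; move: jN => /=; lia.
have E1 := Hc (nth [::] l) N erefl Hl.
rewrite (@expand_rule _ _ _ t j) //= upd_nth /= in E1.
have E2 : exec rule_body (nth [::] l)
    (nth [::] [:: encode (rule_clauses next t j) ++ out; x; m; nm; S; [::]; [::];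
        nseq j.+1 true; nseq j true; nseq t true; w])
    (c * N.+1 + 6).
  apply: exec_cast (ExecSeq E1 (ExecSeq (ExecCase (s' := nth [::]
      [:: encode (rule_clauses next t j) ++ out; x; m; nm; S; [::]; [::];
          nseq j true; nseq j true; nseq t true; w]) (t := 2) _)
    (ExecPush _ _ _))) _ _; last by lia.
    case: (j) => [|j'] /=; first by apply: ExecWeaken (ExecSkip _) _.
    by apply: exec_ext (ExecPush _ _ _) _; rewrite upd_nth.
  by rewrite upd_nth.
have jN' : j.+1 + size w <= N by move: jN => /=; lia.
apply: exec_cast; first by apply: exec_while_nth; [| exact: E2 | exact: (IH j.+1 _ jN')].
- by rewrite addSnnS /= encode_cat -catA.
- by lia.
Qed.

(** [While] pops register 4 before the body runs, so its length is then [B - t.+1], the number of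
    cells to rule. *)
Definition rows_body :=
  Seq (count 4 10 5) (Seq (While 10 rule_body rule_body)
  (Seq (clear 7) (Seq (clear 8) (Push 9 true)))).

Lemma exec_rows_loop : exists c, forall t w out x m nm N,
  t + size w <= N ->
  exec (While 4 rows_body rows_body)
    (nth [::] [:: out; x; m; nm; w; [::]; [::]; [::]; [::]; nseq t true; [::]])
    (nth [::] [:: encode (segments (fun i => segments (rule_clauses next i) 0
                    (t + size w - i.+1)) t (size w)) ++ out;
                  x; m; nm; [::]; [::]; [::]; [::]; [::];
                  nseq (t + size w) true; [::]])
    (size w * (N * (c * N.+1 + 8) + 14 * N + 9) + 1).
Proof.
have [c Hc] := exec_rule_loop; exists c => t w out x m nm N.
elim: w t out => [|b w IH] t out tN /=.
  by rewrite addn0; apply: ExecWhileNil.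
have tN' : t.+1 + size w <= N by move: tN => /=; lia.
have E1 := @exec_count 4 10 5
  (nth [::] [:: out; x; m; nm; w; [::]; [::]; [::]; [::]; nseq t true; [::]]) isT erefl.
rewrite upd_nth /= cats0 in E1.
have E2 := Hc t 0 (nseq (size w) true) out x m nm w N.
rewrite size_nseq add0n /= in E2; have {}E2 := E2 _ _.
have E3 : exec rows_body
    (nth [::] [:: out; x; m; nm; w; [::]; [::]; [::]; [::]; nseq t true; [::]])
    (nth [::] [:: encode (segments (rule_clauses next t) 0 (size w)) ++ out;
        x; m; nm; w; [::]; [::]; [::]; [::]; nseq t.+1 true; [::]])
    (N * (c * N.+1 + 8) + 14 * N + 7).
  apply: exec_cast (ExecSeq E1 (ExecSeq (E2 _ _) (ExecSeq (exec_clear _ _)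
    (ExecSeq (exec_clear _ _) (ExecPush _ _ _))))) _ _; try lia.
    by rewrite !upd_nth.
  rewrite !upd_nth /= !size_nseq.
  have : size w * (c * N.+1 + 8) <= N * (c * N.+1 + 8) by rewrite leq_mul2r; lia.
  by lia.
apply: exec_cast; first by apply: exec_while_nth; [| exact: E3 | exact: (IH t.+1 _ tN')].
- by rewrite -addSnnS addSn subSS addKn encode_cat -catA.
- by lia.
Qed.

(** The argument of [q] is the length of input and witness together. The loop over the rows leaves
    [B] in register 9, and [Pop 9] turns it into the row number [B.-1] of the final clause. *)
Definition tableau_prog (p q : {poly nat}) :=
  foldr Seq Skip
    [:: count 1 3 5; unary_horner p 3 2 6 5; count 2 3 5; unary_horner q 3 4 6 5;
        count 2 4 5; Push 4 true; count 4 10 5;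
        While 10 init_body init_body; clear 7;
        While 4 rows_body rows_body; Pop 9; emit 5 (final_template accepting)].

(** The summand [p.[n]] gives every witness bit a place in row 0; the successor lets row [B.-1]
    reach the time bound [q]. *)
Definition tableau_time (p q : {poly nat}) n := (q.[(n + p.[n]%R)%N]%R + p.[n]%R).+1.

Lemma exec_tableau_prog (p q : {poly nat}) :
  exists2 T, poly_bounded T & forall x, exists2 s',
    exec (tableau_prog p q) (nth [::] [:: [::]; x]) s' (T (size x)) &
    s' 0 = encode (tableau next col0 accepting x p.[size x]%R (tableau_time p q (size x))).
Proof.
have [Tp pTp Hp] := @exec_unary_horner p 3 2 6 5 isT.
have [Tq pTq Hq] := @exec_unary_horner q 3 4 6 5 isT.
have [ci Hi] := exec_init_loop.
have [cr Hr] := exec_rows_loop.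
have [cf Hf] := emits_emit (k := 5) (rs := rs) isT isT isT (template_ok_final accepting).
pose m n := p.[n]%R : nat.
pose B n := tableau_time p q n.
have pm : poly_bounded m by exact: poly_bounded_horner.
have pB : poly_bounded B.
  apply: poly_bounded_succ; apply: poly_bounded_add => //.
  by apply: (@poly_bounded_comp (fun n => q.[n]%R) (fun n => n + p.[n]%R));
    poly_bounded_tac.
exists (fun n => 10 * n + 2 + (Tp n + (10 * m n + 2 + (Tq (n + m n) +
   (10 * m n + 2 + (2 + (10 * B n + 2 + (B n * (ci * (B n).+1 + 6) + 1 +
   (2 * B n + 1 + (B n * (B n * (cr * (B n).+1 + 8) + 14 * B n + 9) + 1 +
   (1 + (cf * (B n).+1 + 0)))))))))))).
  poly_bounded_tac.
  by apply: (@poly_bounded_comp Tq (fun n => n + m n)); poly_bounded_tac.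
move=> x; set n := size x.
pose st out x' m' nm S j t w := nth [::]
  [:: out; x'; m'; nm; S; [::]; [::]; j; [::]; t; w] : store.
have E0 : nth [::] [:: [::]; x] = st [::] x [::] [::] [::] [::] [::] [::].
  by rewrite -(nth_cat_nseq [:: [::]; x] 9).
have E1 : exec (count 1 3 5) (nth [::] [:: [::]; x])
    (st [::] x [::] (nseq n true) [::] [::] [::] [::]) (10 * n + 2).
  apply: exec_ext; first exact: exec_count.
  by rewrite E0 upd_nth /= cats0.
have E2 : exec (unary_horner p 3 2 6 5)
    (st [::] x [::] (nseq n true) [::] [::] [::] [::])
    (st [::] x (nseq (m n) true) (nseq n true) [::] [::] [::] [::]) (Tp n).
  by apply: exec_cast (Hp _ _ _ _) _ _; rewrite // ?upd_nth /= size_nseq.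
have E3 : exec (count 2 3 5)
    (st [::] x (nseq (m n) true) (nseq n true) [::] [::] [::] [::])
    (st [::] x (nseq (m n) true) (nseq (n + m n) true) [::] [::] [::] [::])
    (10 * m n + 2).
  apply: exec_cast (exec_count _ _) _ _ => //; last by rewrite /= size_nseq.
  by rewrite upd_nth /= size_nseq -nseqD addnC.
have E4 : exec (unary_horner q 3 4 6 5)
    (st [::] x (nseq (m n) true) (nseq (n + m n) true) [::] [::] [::] [::])
    (st [::] x (nseq (m n) true) (nseq (n + m n) true) (nseq q.[(n + m n)%N]%R true)
        [::] [::] [::]) (Tq (n + m n)).
  by apply: exec_cast (Hq _ _ _ _) _ _; rewrite // ?upd_nth /= size_nseq.
have E5 : exec (count 2 4 5)
    (st [::] x (nseq (m n) true) (nseq (n + m n) true) (nseq q.[(n + m n)%N]%R true)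
        [::] [::] [::])
    (st [::] x (nseq (m n) true) (nseq (n + m n) true) (nseq (B n).-1 true)
        [::] [::] [::]) (10 * m n + 2).
  apply: exec_cast (exec_count _ _) _ _ => //; last by rewrite /= size_nseq.
  by rewrite upd_nth /= size_nseq -nseqD (addnC (m n)).
have E6 : exec (Push 4 true)
    (st [::] x (nseq (m n) true) (nseq (n + m n) true) (nseq (B n).-1 true)
        [::] [::] [::])
    (st [::] x (nseq (m n) true) (nseq (n + m n) true) (nseq (B n) true)
        [::] [::] [::]) 2.
  by apply: exec_ext (ExecPush _ _ _) _; rewrite upd_nth.
have E7 : exec (count 4 10 5)
    (st [::] x (nseq (m n) true) (nseq (n + m n) true) (nseq (B n) true)
        [::] [::] [::])
    (st [::] x (nseq (m n) true) (nseq (n + m n) true) (nseq (B n) true)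
        [::] [::] (nseq (B n) true)) (10 * B n + 2).
  apply: exec_cast (exec_count _ _) _ _ => //; last by rewrite /nth size_nseq.
  by rewrite upd_nth; rewrite [set_nth _ _ _ _]/= /nth size_nseq cats0.
have E8 := Hi x (m n) 0 (nseq (B n) true) [::] (nseq (n + m n) true)
  (nseq (B n) true) (B n).
rewrite size_nseq add0n drop0 subn0 cats0 in E8; have {}E8 := E8 (leqnn _).
pose s9 j := st (encode (segments (init_clauses col0 x (m n)) 0 (B n)))
  (drop (B n) x) (nseq (m n - B n) true) (nseq (n + m n) true) (nseq (B n) true)
  j [::] [::].
have E9 : exec (clear 7) (s9 (nseq (B n) true)) (s9 [::]) (2 * B n + 1).
  apply: exec_cast (exec_clear _ _) _ _; first by rewrite upd_nth.
  by rewrite -[X in X <= _]/(2 * size (nseq (B n) true) + 1) size_nseq.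
have E10 := Hr 0 (nseq (B n) true)
  (encode (segments (init_clauses col0 x (m n)) 0 (B n)))
  (drop (B n) x) (nseq (m n - B n) true) (nseq (n + m n) true) (B n).
rewrite size_nseq add0n in E10; have {}E10 := E10 (leqnn _).
set out := _ ++ encode _ in E10.
have E11 : exec (Pop 9)
  (st out (drop (B n) x) (nseq (m n - B n) true) (nseq (n + m n) true) [::] [::]
     (nseq (B n) true) [::])
  (st out (drop (B n) x) (nseq (m n - B n) true) (nseq (n + m n) true) [::] [::]
     (nseq (B n).-1 true) [::]) 1.
  by apply: exec_ext (ExecPop _ _) _; rewrite upd_nth.
set s11 := (st out (drop (B n) x) (nseq (m n - B n) true) (nseq (n + m n) true)
   [::] [::] (nseq (B n).-1 true) [::]) in E11.
have E12 := Hf s11 (B n) erefl.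
eexists.
  apply: (ExecSeq E1 (ExecSeq E2 (ExecSeq E3 (ExecSeq E4 (ExecSeq E5 (ExecSeq E6
    (ExecSeq E7 (ExecSeq E8 (ExecSeq E9 (ExecSeq E10 (ExecSeq E11 (ExecSeq (E12 _)
      (ExecSkip _))))))))))))).
  move=> i; rewrite !inE => /or3P[]/eqP-> //.
  by rewrite -[X in X <= _]/(size (nseq (B n).-1 true)) size_nseq leq_pred.
rewrite updxx (@expand_final _ _ _ (B n).-1) //.
by rewrite /tableau 2!encode_cat.
Qed.

End TableauProgram.

(** * Decoding formulas *)

(* Reading from the right, a formula is recovered from the bits of an unfinished
   literal, the literals of an unfinished clause, and the finished clauses. *)
Fixpoint parse (x : word) : option (word * clause * cnf) :=
  match x with
  | [::] => Some ([::], [::], [::])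
  | [:: a, b & x'] =>
    if parse x' is Some (bs, ls, cs) then
      if ~~ a then Some (b :: bs, ls, cs)
      else if ~~ b then
        if bs is s :: v then Some ([::], (s, v) :: ls, cs) else None
      else if nilp bs then Some ([::], [::], ls :: cs) else None
    else None
  | _ => None
  end.

Lemma parse_bits w x bs ls cs : parse x = Some (bs, ls, cs) ->
  parse (encode_bits w ++ x) = Some (w ++ bs, ls, cs).
Proof. by move=> E; elim: w => [|b w IH] //=; rewrite IH. Qed.

Lemma parse_literals c x ls cs : parse x = Some ([::], ls, cs) ->
  parse (flatten (map encode_literal c) ++ x) = Some ([::], c ++ ls, cs).
Proof.
move=> E; elim: c => [|[b v] c IH] //.
set z := flatten _ ++ x in IH.
have -> : flatten (map encode_literal ((b, v) :: c)) ++ x =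
    [:: true, false & encode_bits (b :: v) ++ z] by rewrite /= -catA.
by rewrite [LHS]/= -/(encode_bits v) (parse_bits v IH) cats0.
Qed.

Lemma parse_encode phi : parse (encode phi) = Some ([::], [::], phi).
Proof.
elim: phi => [|c phi IH] //.
have -> : encode (c :: phi) =
    [:: true, true & flatten (map encode_literal c) ++ encode phi] by [].
by rewrite [LHS]/= (parse_literals c IH) cats0.
Qed.

Lemma encode_inj : injective encode.
Proof. by move=> phi psi E; have := parse_encode phi; rewrite E parse_encode => -[->]. Qed.

Lemma parse_sound x bs ls cs : parse x = Some (bs, ls, cs) ->
  x = encode_bits bs ++ flatten (map encode_literal ls) ++ encode cs.
Proof.
have [n] := ubnP (size x); elim: n x bs ls cs => // n IH [|a [|b x]] bs ls cs //=.
  by move=> _ [<- <- <-].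
move=> xn; case E: (parse x) => [[[bs' ls'] cs']|] //.
have -> := IH x _ _ _ _ E; last by lia.
case: a => /=; last by move=> [<- <- <-].
case: b => /=.
  by case: bs' {E} => //= -[<- <- <-].
by case: bs' {E} => //= s v [<- <- <-] /=; rewrite -catA.
Qed.

(** * Hardness *)

Section MachineColumns.
Variable M : machine 2.

Let sym : finType := option (symbol M).

(* Column [j] holds the cells at distance [j] from the head on both sides, the
   state, and a mark for [j = 0]. *)
Definition column : finType := (bool * state M * {ffun tape_id M -> sym * sym})%type.

(** A moving head shifts the two halves of its tape in opposite directions. The marks of [a] and [l]
    single out [j = 0] and [j = 1], where the written symbol or the cell crossing the head turns up.
    At [j = 0] also [l] is marked, so [a] is tested before it. *)
Definition next_column (g l a r : column) : column :=
  if halting g.1.2 then a else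
  let: (q, act) := transition g.1.2 [ffun i => (g.2 i).2] in
  (a.1.1, q, [ffun i =>
    let: (b, mv) := act i in
    match mv with
    | MoveL => ((r.2 i).1,
                if a.1.1 then (a.2 i).1 else if l.1.1 then b else (l.2 i).2)
    | MoveS => ((a.2 i).1, if a.1.1 then b else (a.2 i).2)
    | MoveR => (if a.1.1 then b else (l.2 i).1, (r.2 i).2)
    end]).

Definition start_column (z : bool) (xs ys : option bool) : column :=
  (z, start M, [ffun i =>
    (None, if i is Some (inl k) then omap inl (if k == ord0 then xs else ys) else None)]).

Definition accepting_column : pred column :=
  fun a => (a.2 None).2 == Some (inl true).

Definition config_column (c : config M) (j : nat) : column :=
  (j == 0, c.1, [ffun i => (nth None (c.2 i).1 j, nth None (c.2 i).2 j)]).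

Lemma config_column_step c j :
  config_column (step c) j =
  next_column (config_column c 0) (config_column c j.-1) (config_column c j)
    (config_column c j.+1).
Proof.
rewrite /next_column /= /step; case: ifP => // _.
have -> : [ffun i => ([ffun i => (nth None (c.2 i).1 0, nth None (c.2 i).2 0)] i).2] =
    [ffun i => tape_read (c.2 i)].
  by apply/ffunP => i; rewrite !ffunE /= nth0.
case: transition => q act; rewrite /config_column /=; congr (_, _, _).
apply/ffunP => i; rewrite !ffunE /=.
case: (act i) => b []; case: (c.2 i) => l r /=;
  by case: j => [|[|j]] //=; case: l r => [|? l] [|? r] //=; rewrite ?nth_nil.
Qed.

Lemma row_config x y t j :
  row next_column start_column x y t j =
  config_column (iter t (@step _ M) (init_config M [tuple x; y])) j.
Proof.
elim: t j => [|t IH] j /=; last by rewrite config_column_step !IH.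
have nthE (w : word) : nth None [seq Some (inl b) | b <- w] j =
    omap inl (onth w j) :> option (bool + extra_symbol M).
  by elim: w (j) => [|b w IH] [|i] //=.
rewrite /config_column /start_column /=; congr (_, _, _).
apply/ffunP => i; rewrite !ffunE; case: i => [[k|k]|] /=; rewrite ?nth_nil //.
by rewrite nthE; case: k => -[|[|k]] lt2 //=; rewrite (tnth_nth [::]).
Qed.

Lemma outputs_within_later n n' args w : n <= n' ->
  outputs_within M n args w -> outputs_within M n' args w.
Proof.
move=> le [H <-]; rewrite /outputs_within -(subnK le) iterD.
set c := iter n _ _ in H *.
suff -> : iter (n' - n) (@step _ M) c = c by [].
by elim: (n' - n) => //= k ->; rewrite /step H.
Qed.

(** The output is a single bit, so the cell under the output head decides. *)
Lemma accepting_row x y t b :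
  outputs_within M t [tuple x; y] [:: b] ->
  accepting_column (row next_column start_column x y t 0) = b.
Proof.
rewrite row_config /accepting_column => -[_]; rewrite /output /= ffunE /=.
by case: (_ None).2 => [|[[b'|]|] s] //= [-> _]; case: b.
Qed.

End MachineColumns.

Lemma MNS_hard (L : language) : MNS L -> many_one_reducible L MersenneNumberSAT.
Proof.
move=> [p [R [[M [q HM]] HL]]].
pose B n := tableau_time p q n.
pose phi x := tableau (@next_column M) (@start_column M) (@accepting_column M) x
  p.[size x]%R (B (size x)).
exists (fun x => encode (phi x)).
  have [T [u Tu] H] := exec_tableau_prog (@next_column M) (@start_column M)
    (@accepting_column M) p q.
  apply: (@exec_poly_time 1 _ _ u) => args.
  rewrite big_ord1.
  have [s' E Es] := H (tnth args ord0); exists s' => //.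
  apply: ExecWeaken (Tu _).
  have -> : [::] :: args = [:: [::]; tnth args ord0] :> seq word.
    by case: args {E Es} => -[|a [|]].
  exact: E.
move=> x; have N : num_sat (phi x) = #|[set y : (p.[size x]%R).-tuple bool | R x y]|.
  rewrite num_sat_tableau //; last by rewrite /B /tableau_time; lia.
  apply: eq_card => y; rewrite !inE.
  apply: accepting_row.
  apply: outputs_within_later (HM [tuple x; val y]).
  rewrite big_ord_recl big_ord1 !(tnth_nth [::]) /= size_tuple.
  by rewrite /B /tableau_time; lia.
(* The language only asserts that some formula has this code; injectivity of [encode] identifies it
   with [phi x]. *)
rewrite HL -N; split=> [Hm|[psi /encode_inj <-] //].
by exists (phi x).
Qed.

(** * The verifier *)

Definition table := seq (variable * bool).

Fixpoint lookup (E : table) (v : variable) : option bool :=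
  if E is (u, b) :: E' then if u == v then Some b else lookup E' v else None.

(* The verifier scans the encoding from the right; a variable met for the first
   time takes its value from the next unread bit of the witness. *)
Record vstate := VState {
  vbits : word;
  vtable : table;
  vclause : word;
  vbad : word;
  vrest : word }.

(** A nonempty status is one bit: whether a literal read so far is true. Empty is kept apart from
    [[:: false]] so that literals preceding the first clause mark are detected at the end. *)
Definition use_value (b s : bool) (C : word) : word :=
  if b == s then [:: true] else if C is [::] then [:: false] else C.

Definition literal_step (s : bool) (v : variable) (st : vstate) : vstate :=
  let: VState _ E C bad y := st in
  if lookup E v is Some b then VState [::] E (use_value b s C) bad y
  else VState [::] ((v, head false y) :: E) (use_value (head false y) s C) bad (behead y).

(** Loops have no early exit, so errors pile up on a stack that is inspected at the end. *)
Definition bad_if (c : bool) (bad : word) : word := if c then true :: bad else bad.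

Definition token_step (a b : bool) (st : vstate) : vstate :=
  let: VState bs E C bad y := st in
  if ~~ a then VState (b :: bs) E C bad y
  else if ~~ b then
    if bs is s :: v then literal_step s v st else VState bs E C (true :: bad) y
  else VState bs E [::] (bad_if (~~ head false C) (bad_if (~~ nilp bs) bad)) y.

Fixpoint scan (D : word) (st : vstate) : vstate :=
  match D with
  | [:: b, a & D'] => scan D' (token_step a b st)
  | [:: _] => let: VState bs E C bad y := st in VState bs E C (true :: bad) y
  | [::] => st
  end.

Definition verify (x y : word) : bool :=
  let: VState bs _ C bad y' := scan (rev x) (VState [::] [::] [::] [::] y) in
  [&& nilp bad, nilp bs, nilp C & all negb y'].

(** Moving a name from its stack to the table reverses it, and reading it back onto a stack reverses
    it again. Name bits are preceded by [false]; a pair starting with [true] closes the entry. *)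
Definition encode_entry (e : variable * bool) : word :=
  encode_bits (rev e.1) ++ [:: true; e.2].

Definition encode_table (E : table) : word := flatten (map encode_entry E).

(* Registers: 0 output, 1 formula, 2 unread witness, 3 reversed formula, 4 current
   name, 5 table, 6 clause status (empty: no pending literal), 7 errors, 8 name
   read from the table, 9 copy of the current name, 10 table entries already
   read, 11 result of the lookup, 12 scratch. *)
Definition vst y D bs E C bad V bs' E' F T : store :=
  nth [::] [:: [::]; [::]; y; D; bs; E; C; bad; V; bs'; E'; F; T].

Lemma exec_push_nth i b l :
  exec (Push i b) (nth [::] l) (nth [::] (set_nth [::] l i (b :: nth [::] l i))) 2.
Proof. by rewrite -upd_nth; apply: ExecPush. Qed.

Lemma exec_pop_nth i l :
  exec (Pop i) (nth [::] l) (nth [::] (set_nth [::] l i (behead (nth [::] l i)))) 1.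
Proof. by rewrite -upd_nth; apply: ExecPop. Qed.

Lemma exec_clear_nth i l :
  exec (clear i) (nth [::] l) (nth [::] (set_nth [::] l i [::]))
    (2 * size (nth [::] l i) + 1).
Proof. by rewrite -upd_nth; apply: exec_clear. Qed.

Lemma exec_transfer_nth i j l : i != j ->
  exec (transfer i j) (nth [::] l)
    (nth [::] (set_nth [::] (set_nth [::] l i [::]) j
                 (catrev (nth [::] l i) (nth [::] l j))))
    (4 * size (nth [::] l i) + 1).
Proof. by rewrite -!upd_nth; apply: exec_transfer. Qed.

Lemma exec_while_cons_nth i P Q l b w s s' t t' : nth [::] l i = b :: w ->
  exec (if b then P else Q) (nth [::] (set_nth [::] l i w)) s t ->
  exec (While i P Q) s s' t' ->
  exec (While i P Q) (nth [::] l) s' (t + 2 + t').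
Proof. by move=> E EP EW; apply: ExecWhileCons E _ EW; rewrite upd_nth. Qed.

(** Symbolic execution: final store and time are existential variables filled in along the program,
    and compared with the claimed ones at the end. *)
Ltac xstep :=
  lazymatch goal with
  | |- exec (Seq _ _) _ _ _ => eapply ExecSeq
  | |- exec (Push _ _) _ _ _ => eapply exec_push_nth
  | |- exec (Pop _) _ _ _ => eapply exec_pop_nth
  | |- exec (clear _) _ _ _ => eapply exec_clear_nth
  | |- exec (transfer _ _) _ _ _ => eapply exec_transfer_nth; exact isT
  | |- exec (Case _ _ _ _) _ _ _ => eapply ExecCase
  | |- exec Skip _ _ _ => eapply ExecSkip
  end; cbn [foldr vst nth set_nth behead ncons iter head catrev].
Ltac xrun := repeat xstep.
Ltac xexec := eapply exec_cast; 
  [xrun | by [] | try by cbn [vst nth set_nth behead size]; lia].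

Definition duplicate := Seq (transfer 4 12)
  (While 12 (Seq (Push 4 true) (Push 9 true)) (Seq (Push 4 false) (Push 9 false))).

Lemma exec_duplicate y D bs E C bad V E' F :
  exec duplicate (vst y D bs E C bad V [::] E' F [::])
    (vst y D bs E C bad V bs E' F [::]) (10 * size bs + 2).
Proof.
have L w u v :
  exec (While 12 (Seq (Push 4 true) (Push 9 true)) (Seq (Push 4 false) (Push 9 false)))
    (vst y D u E C bad V v E' F w)
    (vst y D (catrev w u) E C bad V (catrev w v) E' F [::]) (6 * size w + 1).
  elim: w u v => [|b w IH] u v; first exact: ExecWhileNil.
  eapply exec_cast; first eapply (exec_while_cons_nth (t := 4));
    [by [] | | exact: (IH (b :: u) (b :: v)) | by [] | by rewrite /=; lia].
  by case: b; xexec.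
eapply exec_cast; first (eapply ExecSeq; [xstep | exact: L]).
  by rewrite /= -/(rev _) -/(rev _) revK.
by rewrite /= -/(rev _) size_rev; lia.
Qed.

(** One [true] per differing position or surplus bit, so that equality becomes emptiness of a
    stack. *)
Fixpoint mismatches (v u ne : word) : word :=
  match v, u with
  | b :: v', a :: u' => mismatches v' u' (bad_if (a != b) ne)
  | _ :: v', [::] => mismatches v' [::] (true :: ne)
  | [::], _ => nseq (size u) true ++ ne
  end.

Lemma nilp_mismatches v u ne : nilp (mismatches v u ne) = nilp ne && (v == u).
Proof.
elim: v u ne => [|b v IH] [|a u] ne //=; rewrite ?andbT ?IH ?andbF //.
by rewrite eqseq_cons eq_sym; case: eqP => //= _; rewrite andbF.
Qed.

Lemma size_mismatches v u ne : size (mismatches v u ne) <= size v + size u + size ne.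
Proof.
elim: v u ne => [|b v IH] [|a u] ne //=; rewrite ?size_cat ?size_nseq //.
  by apply: leq_trans (IH _ _) _; rewrite /=; lia.
by apply: leq_trans (IH _ _) _; rewrite /bad_if; case: ifP => _ /=; lia.
Qed.

Definition compare_loop := While 8
  (Case 9 (Push 12 true) (Pop 9) (Seq (Pop 9) (Push 12 true)))
  (Case 9 (Push 12 true) (Seq (Pop 9) (Push 12 true)) (Pop 9)).

Definition compare := Seq compare_loop (While 9 (Push 12 true) (Push 12 true)).

Lemma exec_compare y D bs E C bad V u E' F ne :
  exec compare (vst y D bs E C bad V u E' F ne)
    (vst y D bs E C bad [::] [::] E' F (mismatches V u ne))
    (7 * size V + 4 * size u + 2).
Proof.
have L2 : forall w ne, exec (While 9 (Push 12 true) (Push 12 true))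
    (vst y D bs E C bad [::] w E' F ne)
    (vst y D bs E C bad [::] [::] E' F (nseq (size w) true ++ ne)) (4 * size w + 1).
  elim=> [|b w IH] ne'; first exact: ExecWhileNil.
  eapply exec_cast; first eapply (exec_while_cons_nth (t := 2));
    [by [] | | exact: (IH (true :: ne')) | | by rewrite /=; lia].
    by case: b; xexec.
  by rewrite nseq_cat_cons.
(* The loop may stop with a surplus [u'] on register 9; the invariant counts it among the mismatches
   still to be recorded. *)
have L1 : forall V u ne, exists u' ne', [/\ exec compare_loop
    (vst y D bs E C bad V u E' F ne) (vst y D bs E C bad [::] u' E' F ne')
    (7 * size V + 1), nseq (size u') true ++ ne' = mismatches V u ne & size u' <= size u].
  elim=> [|b V' IH] u' ne'; first by exists u', ne'; split=> //; apply: ExecWhileNil.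
  case: u' => [|a u'].
    have [u1 [ne1 [E1 E2 E3]]] := IH [::] (true :: ne').
    exists u1, ne1; split=> //.
    eapply exec_cast; first eapply (exec_while_cons_nth (t := 5));
      [by [] | | exact: E1 | by [] | by rewrite /=; lia].
    by case: b; xexec.
  have [u1 [ne1 [E1 E2 E3]]] := IH u' (bad_if (a != b) ne').
  exists u1, ne1; split=> //; last by rewrite /=; lia.
  eapply exec_cast; first eapply (exec_while_cons_nth (t := 5));
    [by [] | | exact: E1 | by [] | by rewrite /=; lia].
  by case: b {E1 E2}; case: a; xexec.
have [u' [ne' [E1 E2 E3]]] := L1 V u ne.
by eapply exec_cast; first (eapply ExecSeq; [exact: E1 | exact: L2]); [rewrite E2 | lia].
Qed.

(** * Looking up and extending the table *)

Definition match_entry (b : bool) := Seq duplicate (Seq compare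
  (Seq (Case 12 (Case 11 (Push 11 b) Skip Skip) Skip Skip) (clear 12))).

(** As in [lookup] the first hit stays, although the loop goes on through the whole table. *)
Definition first_match (V bs : word) (b : bool) (F : word) : word :=
  if F is [::] then if V == bs then [:: b] else [::] else F.

Lemma exec_match_entry b y D bs E C bad V E' F :
  exec (match_entry b) (vst y D bs E C bad V [::] E' F [::])
    (vst y D bs E C bad [::] [::] E' (first_match V bs b F) [::])
    (16 * size bs + 9 * size V + 11).
Proof.
have EC : exec (Case 12 (Case 11 (Push 11 b) Skip Skip) Skip Skip)
    (vst y D bs E C bad [::] [::] E' F (mismatches V bs [::]))
    (vst y D bs E C bad [::] [::] E' (first_match V bs b F) (mismatches V bs [::])) 6.
  have := nilp_mismatches V bs [::]; rewrite /first_match.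
  by case: mismatches => [|[] ne] /= <-; case: F => [|[] F]; xexec.
eapply exec_cast; first (eapply ExecSeq; first exact: exec_duplicate;
    eapply ExecSeq; first exact: exec_compare; eapply ExecSeq; first exact: EC; xstep).
  by [].
by have := size_mismatches V bs [::]; rewrite /=; lia.
Qed.

(** Bits come in pairs: [While] consumes the mark and [Case] handles its companion. Everything
    popped goes to register 10, from which one transfer rebuilds the table. *)
Definition lookup_loop := While 5
  (Case 5 Skip (foldr Seq Skip [:: Pop 5; Push 10 true; Push 10 true; match_entry true])
     (foldr Seq Skip [:: Pop 5; Push 10 true; Push 10 false; match_entry false]))
  (Case 5 Skip (foldr Seq Skip [:: Pop 5; Push 10 false; Push 10 true; Push 8 true])
     (foldr Seq Skip [:: Pop 5; Push 10 false; Push 10 false; Push 8 false])).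

Definition lookup_name := Seq lookup_loop (transfer 10 5).

Definition lookup_from (E : table) (v F : word) : word :=
  if F is [::] then oapp (fun b => [:: b]) [::] (lookup E v) else F.

Lemma exec_lookup_bits w y D bs E C bad V E' F s t :
  exec lookup_loop (vst y D bs E C bad (catrev w V) [::] (catrev (encode_bits w) E') F [::])
    s t ->
  exec lookup_loop (vst y D bs (encode_bits w ++ E) C bad V [::] E' F [::]) s
    (11 * size w + t).
Proof.
elim: w V E' => [|b w IH] V E' //= H.
eapply exec_cast; first eapply (exec_while_cons_nth (t := 9)); [by [] | |
  exact: (IH (b :: V) [:: b, false & E'] H) | by [] | by lia].
by case: b {H}; xexec.
Qed.

Lemma catrev_catl (T : Type) (u v w : seq T) : catrev (u ++ v) w = catrev v (catrev u w).
Proof. by elim: u w => //=. Qed.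

Lemma size_encode_bits w : size (encode_bits w) = 2 * size w.
Proof. by elim: w => //= b w ->; lia. Qed.

Lemma exec_lookup_loop Tb y D bs C bad E' F N :
  size (encode_table Tb) <= N -> size bs <= N ->
  exec lookup_loop (vst y D bs (encode_table Tb) C bad [::] [::] E' F [::])
    (vst y D bs [::] C bad [::] [::] (catrev (encode_table Tb) E')
       (lookup_from Tb bs F) [::])
    (size Tb * (50 * N + 50) + 1).
Proof.
move=> + bsN; elim: Tb E' F => [|[v b] Tb IH] E' F TN.
  have -> : lookup_from [::] bs F = F by case: F.
  exact: ExecWhileNil.
have szE : size (encode_bits (rev v)) = 2 * size v by rewrite size_encode_bits size_rev.
have E0 : encode_table ((v, b) :: Tb) =
    encode_bits (rev v) ++ [:: true, b & encode_table Tb].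
  by rewrite /encode_table /= /encode_entry -catA.
move: TN; rewrite E0 size_cat szE /= => TN.
have E1 : lookup_from Tb bs (first_match v bs b F) = lookup_from ((v, b) :: Tb) bs F.
  by rewrite /lookup_from /first_match /=; case: F => //; case: eqP.
have TN' : size (encode_table Tb) <= N by lia.
have IH' := IH [:: b, true & catrev (encode_bits (rev v)) E'] (first_match v bs b F) TN'.
rewrite E1 in IH'.
eapply exec_cast; first apply: exec_lookup_bits;
  first eapply (exec_while_cons_nth (t := 16 * size bs + 9 * size v + 18));
  [by [] | | exact: IH' | by rewrite catrev_catl | ].
  rewrite -/(rev _) revK.
  have M := exec_match_entry b y D bs (encode_table Tb) C bad v
    [:: b, true & catrev (encode_bits (rev v)) E'] F.
  case: b {E0 E1 IH'} M => M;
    (eapply exec_cast; first (xstep; xstep; [xstep|]; xstep; [xstep|]; xstep; [xstep|];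
      eapply ExecSeq; [exact: M | xstep])); by [] || by lia.
rewrite size_rev; lia.
Qed.

Lemma size_encode_table_cons v b E :
  size (encode_table ((v, b) :: E)) = 2 * size v + 2 + size (encode_table E).
Proof.
rewrite -[encode_table (_ :: _)]/(encode_entry (v, b) ++ encode_table E).
by rewrite !size_cat size_encode_bits size_rev.
Qed.

Lemma size_encode_table E : 2 * size E <= size (encode_table E).
Proof.
by elim: E => [|[v b] E IH] //; rewrite size_encode_table_cons /=; lia.
Qed.

Lemma exec_lookup_name Tb y D v C bad N :
  size (encode_table Tb) <= N -> size v <= N ->
  exec lookup_name (vst y D v (encode_table Tb) C bad [::] [::] [::] [::] [::])
    (vst y D v (encode_table Tb) C bad [::] [::] [::] (lookup_from Tb v [::]) [::])
    (N * (50 * N + 50) + 4 * N + 2).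
Proof.
move=> TN vN; eapply exec_cast;
  first (eapply ExecSeq; [exact: (exec_lookup_loop _ _ _ _ _ _ TN vN) | xstep]).
  by rewrite -/(rev _) -/(rev _) revK.
rewrite -/(rev _) size_rev.
have : size Tb * (50 * N + 50) <= N * (50 * N + 50).
  by rewrite leq_mul2r; have := size_encode_table Tb; lia.
by lia.
Qed.

Definition add_entry (b : bool) := Seq (Push 5 b) (Seq (Push 5 true)
  (While 4 (Seq (Push 5 true) (Push 5 false)) (Seq (Push 5 false) (Push 5 false)))).

Lemma exec_add_entry b y D v E C bad :
  exec (add_entry b) (vst y D v (encode_table E) C bad [::] [::] [::] [::] [::])
    (vst y D [::] (encode_table ((v, b) :: E)) C bad [::] [::] [::] [::] [::])
    (6 * size v + 5).
Proof.
have L w u : exec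
  (While 4 (Seq (Push 5 true) (Push 5 false)) (Seq (Push 5 false) (Push 5 false)))
  (vst y D w u C bad [::] [::] [::] [::] [::])
  (vst y D [::] (encode_bits (rev w) ++ u) C bad [::] [::] [::] [::] [::])
  (6 * size w + 1).
  elim: w u => [|a w IH] u; first exact: ExecWhileNil.
  eapply exec_cast; first eapply (exec_while_cons_nth (t := 4)); [by [] | |
    exact: (IH [:: false, a & u]) | | by rewrite /=; lia].
    by case: a; xexec.
  by rewrite rev_cons -cats1 encode_bits_cat -catA.
rewrite /add_entry; eapply exec_cast; first (xstep; [xstep |]; xstep; [xstep |]; exact: L);
  last by lia.
by rewrite /encode_table /= /encode_entry -catA.
Qed.

Definition use_prog (b s : bool) :=
  Seq (if b == s then Seq (clear 6) (Push 6 true) else Case 6 (Push 6 false) Skip Skip)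
      (Seq (clear 4) (clear 11)).

Lemma exec_use b s y D v E C bad F : size C <= 1 -> size F <= 1 ->
  exec (use_prog b s) (vst y D v E C bad [::] [::] [::] F [::])
    (vst y D [::] E (use_value b s C) bad [::] [::] [::] [::] [::])
    (2 * size v + 12).
Proof.
move=> C1 F1; rewrite /use_prog /use_value; case: eqP => _.
  by xexec.
by case: C C1 => [|[] C] C1; xexec.
Qed.

Definition fresh_prog (s : bool) :=
  Case 2 (Seq (add_entry false) (use_prog false s))
    (Seq (Pop 2) (Seq (add_entry true) (use_prog true s)))
    (Seq (Pop 2) (Seq (add_entry false) (use_prog false s))).

Definition literal_prog (s : bool) :=
  Seq lookup_name (Case 11 (fresh_prog s) (use_prog true s) (use_prog false s)).

Definition vstore (D : word) (st : vstate) : store :=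
  let: VState bs E C bad y := st in
  vst y D bs (encode_table E) C bad [::] [::] [::] [::] [::].

Lemma exec_literal s D v E C bad y bs0 N :
  size (encode_table E) <= N -> size v <= N -> size C <= 1 ->
  exec (literal_prog s) (vstore D (VState v E C bad y))
    (vstore D (literal_step s v (VState bs0 E C bad y)))
    (N * (50 * N + 50) + 20 * N + 40).
Proof.
move=> EN vN C1; have E1 := exec_lookup_name y D C bad EN vN.
eapply ExecWeaken; first (eapply ExecSeq; first exact: E1;
  eapply (ExecCase (t := 12 * N + 36))).
- rewrite /= /lookup_from; case: (lookup E v) => [b|] /=.
    case: b; (eapply exec_cast; first exact: exec_use);
      by [] || by lia.
  eapply ExecWeaken; first (eapply (ExecCase (t := 12 * N + 30))); last by lia.
  case: y {E1} => [|a y] /=.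
    by eapply exec_cast; first (eapply ExecSeq; [exact: exec_add_entry | exact: exec_use]);
      by [] || by rewrite /=; lia.
  case: a; (eapply exec_cast; first (xstep; [xstep |];
    eapply ExecSeq; [exact: exec_add_entry | exact: exec_use]);
    by [] || by rewrite /=; lia).
- by lia.
Qed.

Definition token_prog (a b : bool) : cmd :=
  if ~~ a then Push 4 b
  else if ~~ b then
    Case 4 (Push 7 true) (Seq (Pop 4) (literal_prog true))
      (Seq (Pop 4) (literal_prog false))
  else Seq (Case 4 Skip (Push 7 true) (Push 7 true))
      (Seq (Case 6 (Push 7 true) Skip (Push 7 true)) (clear 6)).

Definition token_time N := N * (50 * N + 50) + 20 * N + 50.

Lemma exec_token a b D st N :
  size (encode_table (vtable st)) <= N -> size (vbits st) <= N ->
  size (vclause st) <= 1 ->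
  exec (token_prog a b) (vstore D st) (vstore D (token_step a b st)) (token_time N).
Proof.
case: st => bs E C bad y /= EN bsN C1; rewrite /token_prog /token_step /token_time /vstore.
case: a => /=; last by xexec.
case: b => /=.
  by case: bs bsN => [|[] bs] bsN; case: C C1 => [|[] C] /= C1; xexec.
case: bs bsN => [|s v] bsN; first by xexec.
have vN : size v <= N by move: bsN => /=; lia.
have L := exec_literal s D bad y (s :: v) EN vN C1.
by case: s bsN L => bsN L; (eapply exec_cast; first (xstep; xstep; [xstep | exact: L]));
  by [] || by lia.
Qed.

Definition scan_body (b : bool) :=
  Case 3 (Push 7 true) (Seq (Pop 3) (token_prog true b)) (Seq (Pop 3) (token_prog false b)).

Definition scan_prog := While 3 (scan_body true) (scan_body false).

(** A potential: a name bit counts 2, its size in the table, so moving a name there costs nothing,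
    and a token of two input bits adds at most 2. *)
Definition vsize (st : vstate) := 2 * size (vbits st) + size (encode_table (vtable st)).

Lemma vsize_token a b st : vsize (token_step a b st) <= vsize st + 2.
Proof.
case: st => bs E C bad y; rewrite /vsize /token_step; case: a => /=; last by lia.
case: b => /=; first by lia.
case: bs => [|s v]; first by rewrite /=; lia.
rewrite /literal_step; case: (lookup E v) => [b|]; first by rewrite /=; lia.
by rewrite [vtable _]/= size_encode_table_cons /=; lia.
Qed.

Lemma size_vclause_token a b st :
  size (vclause st) <= 1 -> size (vclause (token_step a b st)) <= 1.
Proof.
case: st => bs E C bad y; rewrite /token_step; case: a => //=; case: b => //=.
have U b s : size C <= 1 -> size (use_value b s C) <= 1.
  by rewrite /use_value; case: ifP => // _; case: C.
by case: bs => [|s v] //=; case: (lookup E v) => [b|] /=; apply: U.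
Qed.

Lemma exec_scan D st N : vsize st + size D <= N -> size (vclause st) <= 1 ->
  exec scan_prog (vstore D st) (vstore [::] (scan D st)) (size D * (token_time N + 10) + 1).
Proof.
have [n] := ubnP (size D); elim: n D st => // n IH [|b [|a D]] st Dn DN C1.
- by case: st {DN C1} => *; apply: ExecWhileNil.
- case: st {DN C1} => bs E C bad y.
  eapply exec_cast; first eapply (exec_while_cons_nth (t := 4)
    (s := vstore [::] (VState bs E C (true :: bad) y))); [by [] | |
    exact: ExecWhileNil | by [] | by rewrite /=; lia].
  by rewrite /scan_body; case: (b); xexec.
have vN : vsize (token_step a b st) + size D <= N.
  by have := vsize_token a b st; move: DN => /=; lia.
have Dn' : size D < n by move: Dn => /=; lia.
have {}IH := IH D (token_step a b st) Dn' vN (size_vclause_token a b C1).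
have EN : size (encode_table (vtable st)) <= N by move: DN; rewrite /vsize /=; lia.
have bN : size (vbits st) <= N by move: DN; rewrite /vsize /=; lia.
have Tk := exec_token a b D EN bN C1.
case: st {Dn Dn' DN C1 vN EN bN} Tk IH => bs E C bad y Tk IH.
eapply exec_cast; first eapply (exec_while_cons_nth (t := token_time N + 3));
  [by [] | | exact: IH | by [] | by rewrite /=; lia].
by rewrite /scan_body; case: b Tk {IH} => Tk; case: a Tk => Tk;
  (eapply exec_cast; first (xstep; xstep; [xstep | exact: Tk])); by [] || by lia.
Qed.

Definition verify_prog := foldr Seq Skip
  [:: transfer 1 3; scan_prog; Case 4 Skip (Push 7 true) (Push 7 true);
      Case 6 Skip (Push 7 true) (Push 7 true); While 2 (Push 7 true) Skip;
      Case 7 (Push 0 true) (Push 0 false) (Push 0 false)].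

Lemma size_vrest_scan D st : size (vrest (scan D st)) <= size (vrest st).
Proof.
have [n] := ubnP (size D); elim: n D st => // n IH [|b [|a D]] st Dn //.
  by case: st.
have Dn' : size D < n by move: Dn => /=; lia.
apply: leq_trans (IH D (token_step a b st) Dn') _ => {Dn Dn' IH}.
case: st => bs E C bad y; rewrite /token_step; case: a => //=; case: b => //=.
case: bs => [|s v] //=; case: (lookup E v) => [b|] //=.
by rewrite size_behead leq_pred.
Qed.

Lemma exec_verify x y : exists2 s',
  exec verify_prog (nth [::] [:: [::]; x; y]) s'
    (4 * size x + 1 + (size x * (token_time (size x) + 10) + 1 + (4 + (4 +
      (4 * size y + 1 + 4))))) &
  s' 0 = [:: verify x y].
Proof.
have E1 : exec (transfer 1 3) (nth [::] [:: [::]; x; y])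
    (vstore (rev x) (VState [::] [::] [::] [::] y)) (4 * size x + 1).
  rewrite -(nth_cat_nseq _ 10).
  by eapply exec_cast; first xstep.
have E2 := @exec_scan (rev x) (VState [::] [::] [::] [::] y) (size x).
rewrite size_rev in E2; have {}E2 := E2 (leqnn _) isT.
have := size_vrest_scan (rev x) (VState [::] [::] [::] [::] y).
rewrite /verify; case: scan E2 => bs E C bad y' E2 /= yy.
have E3 : exec (Case 4 Skip (Push 7 true) (Push 7 true))
    (vstore [::] (VState bs E C bad y'))
    (vstore [::] (VState bs E C (bad_if (~~ nilp bs) bad) y')) 4.
  by case: bs {E2} => [|[] bs]; rewrite /vstore; xexec.
set bad1 := bad_if _ _ in E3.
have E4 : exec (Case 6 Skip (Push 7 true) (Push 7 true))
    (vstore [::] (VState bs E C bad1 y'))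
    (vstore [::] (VState bs E C (bad_if (~~ nilp C) bad1) y')) 4.
  by case: C {E2 E3} => [|[] C]; rewrite /vstore; xexec.
set bad2 := bad_if _ _ in E4.
have [bad3 E5 N3] : exists2 bad3, exec (While 2 (Push 7 true) Skip)
    (vstore [::] (VState bs E C bad2 y'))
    (vstore [::] (VState bs E C bad3 [::])) (4 * size y' + 1) &
    nilp bad3 = nilp bad2 && all negb y'.
  elim: y' (bad2) {E2 E3 E4 yy} => [|b y' IH] bd.
    by exists bd; rewrite ?andbT //; apply: ExecWhileNil.
  have [bad3 E5 N3] := IH (bad_if b bd); exists bad3; last first.
    by rewrite N3; case: b {E5 N3}; rewrite //= andbF.
  eapply exec_cast; first eapply (exec_while_cons_nth (t := 2)); [by [] | |
    exact: E5 | by [] | by rewrite /=; lia].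
  by case: b {E5 N3}; xexec.
pose s' := nth [::] [:: [:: nilp bad3]; [::]; [::]; [::]; bs; encode_table E; C; bad3;
  [::]; [::]; [::]; [::]; [::]].
have E6 : exec (Case 7 (Push 0 true) (Push 0 false) (Push 0 false))
    (vstore [::] (VState bs E C bad3 [::])) s' 4.
  by rewrite /s'; case: bad3 {E5 N3 s'} => [|[] bad3]; rewrite /vstore; xexec.
exists s'.
  eapply exec_cast; first exact: (ExecSeq E1 (ExecSeq E2 (ExecSeq E3 (ExecSeq E4
    (ExecSeq E5 (ExecSeq E6 (ExecSkip _))))))); by [] || by lia.
rewrite /s' /= N3 /bad2 /bad1; congr cons.
by case: bs {E2 E3 E4 E5 E6 s' N3 bad1 bad2} => //=; case: C => [|? ?];
  case: bad => //=; rewrite ?andbF.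
Qed.

Lemma poly_time_verify : poly_time_pred2 verify.
Proof.
pose T n := 4 * n + 1 + (n * (token_time n + 10) + 1 + (4 + (4 + (4 * n + 1 + 4)))).
have [q Hq] : poly_bounded T by rewrite /T /token_time; poly_bounded_tac.
apply: (@exec_poly_time 2 _ verify_prog q) => args.
rewrite big_ord_recl big_ord1.
set x := tnth args ord0; have -> : lift ord0 ord0 = ord_max :> 'I_2 by apply: val_inj.
set y := tnth args ord_max.
have -> : [::] :: args = [:: [::]; x; y] :> seq word.
  rewrite /x /y !(tnth_nth [::]) /=.
  by case: args {x y} => -[|a [|b []]].
have [s' E Es] := exec_verify x y; exists s' => //.
apply: ExecWeaken E _; apply: leq_trans (Hq _).
rewrite /T /token_time.
have xN : size x <= size x + size y by lia.
have yN : size y <= size x + size y by lia.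
by rewrite !(leq_add, leq_mul).
Qed.

(** * Membership *)

Definition table_value (E : table) (v : variable) : bool := odflt false (lookup E v).

Lemma lookup_mem E v : (lookup E v != None) = (v \in unzip1 E).
Proof. by elim: E => [|[u b] E IH] //=; rewrite inE (eq_sym v); case: (u =P v). Qed.

Lemma scan_cat D D' st : ~~ odd (size D) -> scan (D ++ D') st = scan D' (scan D st).
Proof.
have [n] := ubnP (size D); elim: n D st => // n IH [|b [|a D]] st //= Dn oD.
by rewrite IH //; [lia | rewrite negbK in oD].
Qed.

Lemma nilp_vbad_token a b st : nilp (vbad (token_step a b st)) -> nilp (vbad st).
Proof.
case: st => bs E C bad y; rewrite /token_step; case: a => //=; case: b => //=.
  by rewrite /bad_if; case: ifP => // _; case: ifP.
by case: bs => [|s v] //=; case: (lookup E v).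
Qed.

Lemma odd_vbad_scan D st : odd (size D) -> ~~ nilp (vbad (scan D st)).
Proof.
have [n] := ubnP (size D); elim: n D st => // n IH [|b [|a D]] st //= Dn oD.
  by case: st.
by rewrite IH //; [lia | rewrite negbK in oD].
Qed.

Lemma parse_even x p : parse x = Some p -> ~~ odd (size x).
Proof.
have [n] := ubnP (size x); elim: n x p => // n IH [|b [|a x]] p //= xn.
case E: (parse x) => [q|] // _; rewrite negbK; apply: IH E; lia.
Qed.

Definition names (ls : clause) (cs : cnf) : seq variable :=
  [seq l.2 | l <- ls ++ flatten cs].

Definition pending (E : table) (ls : clause) : word :=
  if ls is [::] then [::]
  else [:: has (fun l : literal => table_value E l.2 == l.1) ls].

(** Two bits put in front of [x] are one more layer of [parse] and one more token at the end of the
    scan of [rev x], so one induction serves both. *)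
Definition scan_spec (x y : word) : Prop :=
  let st := scan (rev x) (VState [::] [::] [::] [::] y) in
  if parse x is Some (bs, ls, cs) then
    let: VState bs' E C bad y' := st in
    [/\ bs' = bs, unzip1 E = undup (names ls cs), size E <= size x,
        y = rev (unzip2 E) ++ y' & C = pending E ls /\ nilp bad = sat (table_value E) cs]
  else ~~ nilp (vbad st).

Lemma table_value_cons v b E u : u != v -> table_value ((v, b) :: E) u = table_value E u.
Proof. by rewrite /table_value /= eq_sym => /negPf ->. Qed.

Lemma use_value_pending E s v ls b : table_value E v = b ->
  use_value b s (pending E ls) = pending E ((s, v) :: ls).
Proof.
by rewrite /use_value /= => ->; case: eqP; case: ls.
Qed.

(** [undup] keeps a name put in front exactly if it does not occur further right, which is when the
    table grows. The clauses already read do not contain the new name, so their truth is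
    unchanged. *)
Lemma scanP x y : ~~ odd (size x) -> size x <= size y -> scan_spec x y.
Proof.
have [n] := ubnP (size x); elim: n x => // n IH [|a [|b x]] //= xn; rewrite ?negbK => ox xy.
have {}IH : scan_spec x y by apply: IH => //; lia.
move: IH; rewrite /scan_spec /= !rev_cons -!cats1 -catA scan_cat ?size_rev //=.
move: (scan _ _) => st.
case: (parse x) => [[[bs ls] cs]|]; last first.
  by apply: contra; apply: nilp_vbad_token.
case: st => bs' E C bad y' [-> En Es Ey [-> Eb]].
case: a => /=; last by split=> //; lia.
case: b => /=; last first.
  case: bs => [|s v] //=; case El: (lookup E v) => [b|] /=.
    have vE : v \in undup (names ls cs) by rewrite -En -lookup_mem El.
    split=> //; try lia.
      by rewrite /names /= -/(names ls cs); rewrite mem_undup in vE; rewrite vE.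
    by split=> //; rewrite (@use_value_pending _ _ v) // /table_value El.
  have vE : v \notin names ls cs by rewrite -mem_undup -En -lookup_mem El.
  have eqE b l : l \in names ls cs -> table_value ((v, b) :: E) l = table_value E l.
    by move=> lE; rewrite table_value_cons //; apply: contraNneq vE => <-.
  (* The witness is not exhausted: every entry took one bit of it, and
     [size E <= size x < size y]. *)
  have [b [y'' Ey']] : exists b y'', y' = b :: y''.
    case: y' Ey => [|b y''] Ey; last by exists b, y''.
    by move: xy; rewrite Ey cats0 size_rev size_map; lia.
  rewrite Ey' /=; split=> //.
  - by rewrite /names /= -/(names ls cs) (negPf vE) En.
  - by lia.
  - by rewrite rev_cons cat_rcons -Ey'.
  split.
    rewrite -[RHS]/(pending ((v, b) :: E) ((s, v) :: ls)).
    rewrite -(@use_value_pending _ s v ls b); last by rewrite /table_value /= eqxx.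
    congr use_value; case: (ls) eqE => [|l0 ls'] //= eqE; congr [:: _].
    rewrite eqE ?inE ?eqxx //; congr orb; apply: eq_in_has => l lls /=.
    by rewrite eqE // /names map_f // mem_cat inE lls orbT.
  rewrite Eb; apply: eq_in_all => c cc; apply: eq_in_has => l lc /=.
  rewrite eqE // /names map_f // mem_cat; apply/orP; right.
  by apply/flattenP; exists c.
case: bs => [|s v] /=; last by rewrite /bad_if; case: ifP.
split=> //; first by lia.
split=> //; rewrite /bad_if /pending.
by case: (ls) => [|l ls'] //=; rewrite -Eb; case: (_ || _).
Qed.

(** An odd length or a failed parse leaves an error, and a complete parse determines the word. *)
Lemma verify_sound x y : size x <= size y -> verify x y -> exists phi, x = encode phi.
Proof.
rewrite /verify => xy; case: (boolP (odd (size x))) => ox.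
  have := @odd_vbad_scan (rev x) (VState [::] [::] [::] [::] y).
  by rewrite size_rev => /(_ ox); case: scan => bs E C bad y' /= /negPf ->.
have := scanP ox xy; rewrite /scan_spec.
case Ep: (parse x) => [[[bs ls] cs]|].
  case: scan => bs' E C bad y' [-> _ _ _ [-> _]] /and4P[_ /nilP b0 l0 _].
  have {}l0 : ls = [::] by case: (ls) l0.
  by exists cs; rewrite (parse_sound Ep) b0 l0.
by case: scan => bs E C bad y' /= /negPf ->.
Qed.

Lemma verify_encode phi y : size (encode phi) <= size y ->
  exists E y', [/\ unzip1 E = vars phi, y = rev (unzip2 E) ++ y' &
    verify (encode phi) y = sat (table_value E) phi && all negb y'].
Proof.
move=> xy; have ox := parse_even (parse_encode phi).
have := scanP ox xy; rewrite /scan_spec parse_encode /verify.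
case: scan => bs E C bad y' [-> En _ Ey [-> ->]].
by exists E, y'.
Qed.

Lemma lookup_map E (f : variable -> bool) v :
  unzip2 E = map f (unzip1 E) -> v \in unzip1 E -> table_value E v = f v.
Proof.
elim: E => [|[u b] E IH] //= [-> /IH H]; rewrite inE /table_value /= eq_sym.
by case: eqP => [-> //|_] /=; apply: H.
Qed.

Lemma map_table_value E : uniq (unzip1 E) -> map (table_value E) (unzip1 E) = unzip2 E.
Proof.
elim: E => [|[v b] E IH] //= /andP[vE uE].
rewrite {1}/table_value /= eqxx /= -[in RHS]IH //; congr cons.
apply/eq_in_map => u uE'; rewrite table_value_cons //.
by apply: contraNneq vE => <-.
Qed.

Lemma card_verify phi n : n = size (encode phi) ->
  #|[set y : n.-tuple bool | verify (encode phi) y]| = num_sat phi.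
Proof.
move=> En; pose k := size (vars phi).
(* Running the verifier on zeros shows this: the table has an entry for each variable, and took the
   values from a word of length [n]. *)
have kn : k <= n.
  have [|E [y' [E1 E2 _]]] := @verify_encode phi (nseq n false).
    by rewrite size_nseq En.
  have := congr1 size E2; rewrite size_nseq size_cat size_rev /k -E1 !size_map; lia.
(* The table, and so [vars phi], has the newest name in front, while the witness is read oldest
   first; hence [rev]. *)
pose s (a : assignment phi) := rev (map (value a) (vars phi)) ++ nseq (n - k) false.
have ss a : size (s a) == n.
  by rewrite size_cat size_rev size_map size_nseq subnKC.
pose h a : n.-tuple bool := Tuple (ss a).
have hinj : injective h.
  move=> a a' /(congr1 val) /= /eqP; rewrite eqseq_cat ?size_rev ?size_map //.
  rewrite (inj_eq (inv_inj revK)) => /andP[/eqP /eq_in_map E _].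
  by apply/ffunP => w; rewrite -!value_mem E // ssvalP.
rewrite /num_sat -(card_imset _ hinj); congr #|pred_of_set _|.
apply/setP => y; rewrite inE.
have [|E [y' [E1 E2 ->]]] := @verify_encode phi y; first by rewrite size_tuple En.
have sE : size (unzip2 E) = k by rewrite /k -E1 !size_map.
apply/andP/imsetP => [[Sy Fy]|[a + Ey]].
  pose a : assignment phi := [ffun w => table_value E (val w)].
  have va : {in vars phi, value a =1 table_value E}.
    by move=> w ww; rewrite -[w]/(val (SeqSub ww)) value_mem ffunE.
  exists a; first by rewrite inE -[satisfies a]/(sat (value a) phi) (eq_sat va).
  apply: val_inj => /=; rewrite E2 /s.
  have -> : map (value a) (vars phi) = unzip2 E.
    rewrite -map_table_value E1; last exact: undup_uniq.
    exact/eq_in_map.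
  congr cat; have -> : n - k = size y'.
    by have := size_tuple y; rewrite E2 size_cat size_rev sE => <-; rewrite addKn.
  by elim: (y') Fy => [|[] w IH] //= /IH <-.
rewrite inE -[satisfies a]/(sat (value a) phi).
move: E2; rewrite Ey /= => /eqP; rewrite eqseq_cat ?size_rev ?size_map //; last first.
  by rewrite -/k -sE size_map.
rewrite (inj_eq (inv_inj revK)) => /andP[/eqP E3 /eqP <-] Sa; split.
  rewrite (@eq_sat _ (value a)) // => v; rewrite -E1 => vE.
  by apply: lookup_map vE; rewrite E1.
by rewrite all_nseq orbT.
Qed.

Lemma MersenneNumberSAT_in_MNS : MNS MersenneNumberSAT.
Proof.
exists 'X%R, verify; split; first exact: poly_time_verify.
move=> x; rewrite /MersenneNumberSAT; set n := ('X.[size x])%R.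
have {}En : n = size x by rewrite /n hornerX.
move: n En => n En; split=> [[phi Ex]|Hm].
  by rewrite Ex card_verify // -Ex.
have [phi Ex] : exists phi, x = encode phi.
  (* As [1 <= t], the count is positive, so some witness is accepted. *)
  have /card_gt0P [y] : 0 < #|[set y : n.-tuple bool | verify x y]|.
    by case: Hm => -[|t] // _ ->; rewrite subn_gt0 -{1}(expn0 2) ltn_exp2l.
  by rewrite inE; apply: verify_sound; rewrite size_tuple En.
by exists phi => //; move: Hm; rewrite Ex card_verify // -Ex.
Qed.

Theorem theorem1 :
  MNS MersenneNumberSAT /\
  forall L : language, MNS L -> many_one_reducible L MersenneNumberSAT.
Proof. by split; [exact: MersenneNumberSAT_in_MNS | exact: MNS_hard]. Qed.
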